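(* Let $(X,\Sigma,\mathfrak m)$ be a complete, $\sigma$-finite measure space. Let $\mathscr M$ be a countably-generated normed $L^0(\mathfrak m)$-module. Let $\mathbb B$ be a universal separable Banach space. Then there exists a separable Banach $\mathbb B$-bundle $\mathbf E$ over $X$ such that $\Gamma(\mathbf E)\cong\mathscr M$, i.e. $\Gamma(\mathbf E)$ and $\mathscr M$ are isomorphic as normed $L^0(\mathfrak m)$-modules.
   Context: Measurable spaces $(X,\Sigma)$ are assumed to satisfy $\{x\}\in\Sigma$ for every $x\in X$. Banach spaces are real. $L^0(\mathfrak m)$: the ring of $\mathfrak m$-a.e. equivalence classes of measurable functions $X\to\mathbb R$, with the distance $d_{L^0(\mathfrak m)}(f,g)=\int\min\{|f-g|,1\}\,d\mathfrak m'$, where $\mathfrak m'$ is a fixed probability measure with $\mathfrak m\ll\mathfrak m'\ll\mathfrak m$ (the induced topology does not depend on $\mathfrak m'$). Normed $L^0(\mathfrak m)$-module: a couple $(\mathscr M,|\cdot|)$ where $\mathscr M$ is an algebraic $L^0(\mathfrak m)$-module, the pointwise norm $|\cdot|\colon\mathscr M\to L^0(\mathfrak m)$ satisfies, $\mathfrak m$-a.e., $|v|\ge0$ with equality iff $v=0$, $|v+w|\le|v|+|w|$, $|f\cdot v|=|f||v|$ for all $f\in L^0(\mathfrak m)$, $v,w\in\mathscr M$, and the distance $d_{\mathscr M}(v,w):=d_{L^0(\mathfrak m)}(|v-w|,0)$ is complete. An isomorphism of normed $L^0(\mathfrak m)$-modules is an $L^0(\mathfrak m)$-linear bijection preserving the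 pointwise norm. $\mathscr M$ is countably-generated if there is a countable set $\mathcal C\subseteq\mathscr M$ such that the smallest algebraic $L^0(\mathfrak m)$-submodule containing $\mathcal C$ is $d_{\mathscr M}$-dense in $\mathscr M$. Universal separable Banach space: a separable Banach space $\mathbb B$ such that every separable Banach space admits a linear isometric embedding into $\mathbb B$. $\mathrm{Gr}(\mathbb B)$ is the family of closed linear subspaces of $\mathbb B$. A separable Banach $\mathbb B$-bundle over $X$ is a map $\mathbf E\colon X\to\mathrm{Gr}(\mathbb B)$ that is weakly measurable as a correspondence: $\{x\in X:\mathbf E(x)\cap U\ne\emptyset\}\in\Sigma$ for every open $U\subseteq\mathbb B$. A section of $\mathbf E$ is a measurable map $\bar s\colon X\to\mathbb B$ with $\bar s(x)\in\mathbf E(x)$ for all $x$; $\bar\Gamma(\mathbf E)$ is the space of sections. $\Gamma(\mathbf E)$ is the quotient of $\bar\Gamma(\mathbf E)$ by $\mathfrak m$-a.e. equality (equivalently, the $L^0$-completion of the space $\Gamma_b(\mathbf E)$ of classes of bounded sections), with the natural pointwise operations and pointwise norm $|s|(x)=\|s(x)\|_{\mathbb B}$; it is a normed $L^0(\mathfrak m)$-module. *)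

(* Defs.v *)
From HB Require Import structures.
From mathcomp Require Import all_boot all_order all_algebra.
From mathcomp Require Import all_classical all_reals all_analysis.
From mathcomp Require Import measurable_realfun.

Set Implicit Arguments.
Unset Strict Implicit.
Unset Printing Implicit Defensive.
Import Order.TTheory GRing.Theory Num.Theory.
Import numFieldNormedType.Exports.
Local Open Scope classical_set_scope.
Local Open Scope ring_scope.
Local Open Scope quotient_scope.

Section L0.
Context {d : measure_display} {X : measurableType d} {R : realType}.
Variable mu : {measure set X -> \bar R}.

Definition L0 : Type := {mfun_ mu, X >-> R}.
HB.instance Definition _ := Choice.on L0.
HB.instance Definition _ := EqQuotient.on L0.
Definition L0_fun (f : L0) : X -> R := aqEqMfun_to_fun f.
Coercion L0_fun : L0 >-> Funclass.

Definition L0class (f : {mfun X >-> R}) : L0 := \pi_L0 f.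

Lemma L0classE (f : {mfun X >-> R}) : \forall x \ae mu, L0class f x = f x.
Proof.
have /eqmodP/asboolP : repr (L0class f) = f %[mod L0] by rewrite reprK.
by apply: filterS => x; apply.
Qed.

Lemma L0P (f g : L0) : (\forall x \ae mu, f x = g x) -> f = g.
Proof.
move=> fg; rewrite -[f]reprK -[g]reprK; apply/eqmodP/asboolP.
by apply: filterS fg => x.
Qed.

Lemma measurable_L0 (f : L0) : measurable_fun setT (f : X -> R).
Proof. exact: (@measurable_funPT _ _ _ _ (repr f : {mfun X >-> R})). Qed.

Definition L0_add (f g : L0) : L0 := L0class (repr f + repr g).
Definition L0_opp (f : L0) : L0 := L0class (- repr f).
Definition L0_mul (f g : L0) : L0 := L0class (repr f * repr g).

Fact L0_addE f g : \forall x \ae mu, L0_add f g x = f x + g x.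
Proof. exact: L0classE. Qed.
Fact L0_oppE f : \forall x \ae mu, L0_opp f x = - f x.
Proof. exact: L0classE. Qed.
Fact L0_mulE f g : \forall x \ae mu, L0_mul f g x = f x * g x.
Proof. exact: L0classE. Qed.

Fact L0_addA : associative L0_add.
Proof.
move=> f g h; apply: L0P; near=> x.
rewrite (near (L0_addE f (L0_add g h)) x)//.
rewrite (near (L0_addE g h) x)//.
rewrite (near (L0_addE (L0_add f g) h) x)//.
by rewrite (near (L0_addE f g) x)// addrA.
Unshelve. all: by end_near. Qed.

Fact L0_addC : commutative L0_add.
Proof. by move=> f g; rewrite /L0_add addrC. Qed.

Fact L0_add0 : left_id (L0class 0) L0_add.
Proof.
move=> f; apply: L0P; near=> x.
rewrite (near (L0_addE (L0class 0) f) x)//.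
by rewrite (near (L0classE 0) x)//= add0r.
Unshelve. all: by end_near. Qed.

Fact L0_addN : left_inverse (L0class 0) L0_opp L0_add.
Proof.
move=> f; apply: L0P; near=> x.
rewrite (near (L0_addE (L0_opp f) f) x)//.
by rewrite (near (L0_oppE f) x)// (near (L0classE 0) x)//= addNr.
Unshelve. all: by end_near. Qed.

HB.instance Definition _ :=
  GRing.isZmodule.Build L0 L0_addA L0_addC L0_add0 L0_addN.

Fact L0_mulA : associative L0_mul.
Proof.
move=> f g h; apply: L0P; near=> x.
rewrite (near (L0_mulE f (L0_mul g h)) x)//.
rewrite (near (L0_mulE g h) x)//.
rewrite (near (L0_mulE (L0_mul f g) h) x)//.
by rewrite (near (L0_mulE f g) x)// mulrA.
Unshelve. all: by end_near. Qed.

Fact L0_mulC : commutative L0_mul.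
Proof. by move=> f g; rewrite /L0_mul mulrC. Qed.

Fact L0_mul1 : left_id (L0class 1) L0_mul.
Proof.
move=> f; apply: L0P; near=> x.
rewrite (near (L0_mulE (L0class 1) f) x)//.
by rewrite (near (L0classE 1) x)//= mul1r.
Unshelve. all: by end_near. Qed.

Fact L0_mulDl : left_distributive L0_mul +%R.
Proof.
move=> f g h; apply: L0P; near=> x.
rewrite (near (L0_mulE (f + g) h) x)//.
rewrite (near (L0_addE f g) x)//.
rewrite (near (L0_addE (L0_mul f h) (L0_mul g h)) x)//.
rewrite (near (L0_mulE f h) x)//.
by rewrite (near (L0_mulE g h) x)// mulrDl.
Unshelve. all: by end_near. Qed.

(* [L0 mu] is the zero ring when [mu] is the zero measure, whence the
   possibly trivial ring structure. *)
HB.instance Definition _ :=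
  GRing.Zmodule_isComPzRing.Build L0 L0_mulA L0_mulC L0_mul1 L0_mulDl.

Lemma L0D (f g : L0) : \forall x \ae mu, (f + g : L0) x = f x + g x.
Proof. exact: L0_addE. Qed.
Lemma L0N (f : L0) : \forall x \ae mu, (- f : L0) x = - f x.
Proof. exact: L0_oppE. Qed.
Lemma L0M (f g : L0) : \forall x \ae mu, (f * g : L0) x = f x * g x.
Proof. exact: L0_mulE. Qed.
Lemma L00 : \forall x \ae mu, (0 : L0) x = 0.
Proof. exact: L0classE. Qed.
Lemma L01 : \forall x \ae mu, (1 : L0) x = 1.
Proof. exact: L0classE. Qed.

End L0.

Arguments L0 {d X R} mu.

(* If [mu] is not zero, this is a probability measure [m'] such that
   [mu << m' << mu]. If [mu] is zero no such probability measure exists; the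
   condition [eprob_setT] is then dropped, so that [m'] is zero. *)
Record equivProbability {d : measure_display} {X : measurableType d}
    {R : realType} (mu : {measure set X -> \bar R}) := EquivProbability {
  eprob :> {measure set X -> \bar R} ;
  eprob_ll : eprob `<< mu ;
  ll_eprob : mu `<< eprob ;
  eprob_setT : mu [set: X] != 0%E -> eprob [set: X] = 1%E }.

Definition L0dist {d : measure_display} {X : measurableType d} {R : realType}
    {mu : {measure set X -> \bar R}} (m' : equivProbability mu)
    (f g : L0 mu) : R :=
  \int[m']_x Num.min `|f x - g x| 1.

HB.mixin Record Lmodule_isNormedL0Module (d : measure_display)
    (X : measurableType d) (R : realType) (mu : {measure set X -> \bar R})
    (m' : equivProbability mu) V & GRing.Lmodule (L0 mu) V := {
  pnorm : V -> L0 mu ;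
  pnorm_ge0 : forall v, \forall x \ae mu, 0 <= pnorm v x ;
  pnorm_eq0 : forall v, pnorm v = 0 <-> v = 0 ;
  ler_pnormD : forall v w,
    \forall x \ae mu, pnorm (v + w) x <= pnorm v x + pnorm w x ;
  pnormZ : forall (f : L0 mu) v,
    \forall x \ae mu, pnorm (f *: v) x = `|f x| * pnorm v x ;
  L0_complete : forall u : nat -> V,
    (forall e : R, 0 < e -> exists N, forall i j, (N <= i)%N -> (N <= j)%N ->
      L0dist m' (pnorm (u i - u j)) 0 < e) ->
    exists v, L0dist m' (pnorm (u n - v)) 0 @[n --> \oo] --> (0 : R)
}.

#[short(type="normedL0ModType")]
HB.structure Definition NormedL0Module (d : measure_display)
    (X : measurableType d) (R : realType) (mu : {measure set X -> \bar R})
    (m' : equivProbability mu) :=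
  {V of GRing.Lmodule (L0 mu) V & @Lmodule_isNormedL0Module d X R mu m' V}.

Section normedL0Module.
Context {d : measure_display} {X : measurableType d} {R : realType}.
Context {mu : {measure set X -> \bar R}} {m' : equivProbability mu}.

Definition mdistL0 (V : normedL0ModType m') (v w : V) : R :=
  L0dist m' (pnorm (v - w)) 0.

Definition L0submodule (V : normedL0ModType m') (N : set V) : Prop :=
  N 0 /\ forall (f : L0 mu) v w, N v -> N w -> N (f *: v + w).

Definition L0span (V : normedL0ModType m') (C : set V) : set V :=
  smallest (@L0submodule V) C.

Definition countably_generated (V : normedL0ModType m') : Prop :=
  exists2 C : set V, countable C &
    forall v (e : R), 0 < e -> exists2 w, L0span C w & mdistL0 v w < e.

Definition isomorphic (V W : normedL0ModType m') : Prop :=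
  exists2 phi : {linear V -> W}, bijective phi &
    forall v, pnorm (phi v) = pnorm v.

End normedL0Module.

HB.mixin Record isSeparable T & Topological T := {
  separable_subproof : exists2 D : set T, countable D & dense D
}.

#[short(type="sepBanachType")]
HB.structure Definition SeparableBanach (R : realType) :=
  {B of CompleteNormedModule R B & isSeparable B}.

Definition universal {R : realType} (B : sepBanachType R) : Prop :=
  forall V : sepBanachType R,
    exists f : {linear V -> B}, forall v, `|f v| = `|v|.

Definition borel (T : ptopologicalType) := g_sigma_algebraType (@open T).

Record Gr {R : realType} (B : normedModType R) := ClosedSubspace {
  Gr_set :> set B ;
  Gr_closed : closed Gr_set ;
  Gr0 : Gr_set 0 ;
  GrP : forall (a : R) u v, Gr_set u -> Gr_set v -> Gr_set (a *: u + v) }.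

Record bundle {d : measure_display} (X : measurableType d) {R : realType}
    (B : sepBanachType R) := Bundle {
  fiber :> X -> Gr B ;
  measurable_fiber : forall U : set B, open U ->
    measurable [set x | fiber x `&` U !=set0] }.

Record section {d : measure_display} {X : measurableType d} {R : realType}
    {B : sepBanachType R} (E : bundle X B) := Section {
  section_fun :> X -> B ;
  measurable_section : measurable_fun [set: X] (section_fun : X -> borel B) ;
  section_in : forall x, (E x : set B) (section_fun x) }.

Section borel.
Context {d : measure_display} {X : measurableType d}.

Lemma measurable_borel (T : ptopologicalType) (f : X -> T) :
  (forall U, open U -> measurable (f @^-1` U)) ->
  measurable_fun [set: X] (f : X -> borel T).
Proof.
move=> mf; apply: (@measurability _ _ X (borel T) setT f (@open T) erefl).
by move=> _ [U oU <-]; rewrite setTI; exact: mf.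
Qed.

Lemma borel_open (T : ptopologicalType) (f : X -> T) (U : set T) :
  measurable_fun [set: X] (f : X -> borel T) -> open U ->
  measurable (f @^-1` U).
Proof.
move=> mf oU; rewrite -[X in measurable X]setTI; apply: mf => //.
exact: sub_sigma_algebra.
Qed.

Lemma measurable_comp2 (S T V : topologicalType)
    (h : S * T -> V) (f : X -> S) (g : X -> T) :
  @second_countable S -> @second_countable T -> continuous h ->
  (forall U, open U -> measurable (f @^-1` U)) ->
  (forall U, open U -> measurable (g @^-1` U)) ->
  forall U, open U -> measurable ((fun x => h (f x, g x)) @^-1` U).
Proof.
move=> [A cA [Ao Ab]] [B cB [Bo Bb]] ch mf mg U oU.
pose I := [set C : set S * set T | A C.1 /\ B C.2 /\ C.1 `*` C.2 `<=` h @^-1` U].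
have cI : countable I.
  by apply: (sub_countable _ (countableX cA cB)); apply: subset_card_le => C [? []].
have -> : (fun x => h (f x, g x)) @^-1` U =
    \bigcup_(C in I) (f @^-1` C.1 `&` g @^-1` C.2).
  apply/seteqP; split=> [x /= Ux|x [C [_ [_ CU]] [Cf Cg]]]; last first.
    by apply: (CU (f x, g x)).
  have : nbhs (f x, g x) (h @^-1` U).
    by apply: ch; exact: open_nbhs_nbhs.
  case=> -[P Q] /= [/Ab [P' [AP' P'x] P'P] /Bb [Q' [BQ' Q'x] Q'Q]] PQ.
  exists (P', Q') => //=; split=> //; split=> // -[s t] /= [P's Q't].
  by apply: (PQ (s, t)); split; [exact: P'P|exact: Q'Q].
have mI C : I C -> measurable (f @^-1` C.1 `&` g @^-1` C.2).
  by move=> [/Ao oC1 [/Bo oC2 _]]; apply: measurableI; [exact: mf|exact: mg].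
have [->|/set0P I0] := eqVneq I set0; first by rewrite bigcup_set0.
have /pfcard_geP[I0'|[n]] := cI; first by rewrite I0' bigcup_set0.
rewrite -(image_eq n) bigcup_image.
by apply: bigcup_measurable => k _; exact/mI/funS.
Qed.

Lemma measurable_borel_lim {R : realType} (T : pseudoPMetricType R)
    (f : nat -> X -> T) (g : X -> T) :
  (forall n U, open U -> measurable (f n @^-1` U)) ->
  (forall x, f n x @[n --> \oo] --> g x) ->
  forall U, open U -> measurable (g @^-1` U).
Proof.
move=> mf fg U oU.
pose W m := \bigcup_(z in ~` U) (ball z (m.+1%:R^-1 : R))°.
have oW m : open (W m) by apply: bigcup_open => z _; exact: open_interior.
have -> : g @^-1` U =
    \bigcup_m \bigcup_K \bigcap_k (f (K + k)%N @^-1` (~` W m)).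
  apply/seteqP; split=> [x Ux|x].
    have /nbhs_ballP[e /= e0 eU] : nbhs (g x) U by exact: open_nbhs_nbhs.
    have e20 : 0 < e / 2 by rewrite divr_gt0.
    have [m] := ltr_add_invr e20; rewrite add0r => me.
    exists m => //.
    have : \forall n \near \oo, ball (g x) (e / 2) (f n x).
      by apply: (fg x); exact: nbhsx_ballx.
    case=> K _ Kf; exists K => // k _ /= [z Uz /interior_subset zf].
    apply: Uz; apply: eU; rewrite (splitr e); apply: (ball_triangle (Kf (K + k)%N _)).
      by rewrite /= leq_addr.
    by apply: ball_sym; exact: (le_ball (ltW me)).
  case=> m _ [K _ Kf]; apply: contrapT => nUg.
  have : \forall n \near \oo, (ball (g x) (m.+1%:R^-1 : R))° (f n x).
    apply: (fg x); apply: open_nbhs_nbhs; split; first exact: open_interior.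
    by apply: nbhsx_ballx.
  case=> N _ /(_ (K + N)%N) /= Nf.
  by apply: (Kf N) => //; exists (g x) => //; apply: Nf; rewrite leq_addl.
apply: bigcupT_measurable => m; apply: bigcupT_measurable => K.
apply: bigcapT_measurable => k; rewrite preimage_setC; apply: measurableC.
exact: (mf (K + k)%N _ (oW m)).
Qed.

End borel.

Lemma separable_second_countable {R : realType} (T : normedModType R)
    (D : set T) : countable D -> dense D -> @second_countable T.
Proof.
move=> cD dD; exists ((fun zn : T * nat => ball zn.1 (zn.2.+1%:R^-1 : R)) @`
    (D `*` [set: nat])).
  by apply: (sub_countable (card_image_le _ _)); exact: countableX.
split; first by move=> _ [[z n] _ <-] /=; exact: ball_open.
move=> x V /nbhs_ballP[e /= e0 eV].
have e20 : 0 < e / 2 by rewrite divr_gt0.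
have [m] := ltr_add_invr e20; rewrite add0r => me.
have m0 : 0 < (m.+1%:R^-1 : R) by [].
have [|z [xz Dz]] := dD (ball x (m.+1%:R^-1 : R)) _ (ball_open _ _).
  by exists x; exact: ballxx.
exists (ball z (m.+1%:R^-1 : R)).
  by split; [exists (z, m)|exact: ball_sym].
move=> y zy; apply: eV; rewrite (splitr e).
by apply: (@ball_triangle _ _ z); apply: (le_ball (ltW me)).
Qed.

Section normed_borel.
Context {d : measure_display} {X : measurableType d} {R : realType}.

Lemma second_countable_R : @second_countable R.
Proof.
apply: (@separable_second_countable R R^o _ _ (@dense_rat R)).
by apply: (sub_countable (card_image_le _ _)).
Qed.

Lemma second_countable_sepBanach (B : sepBanachType R) : @second_countable B.
Proof.
by have [D cD dD] := @separable_subproof R B; exact: separable_second_countable dD.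
Qed.

Lemma measurable_openP (f : X -> R) : measurable_fun [set: X] f <->
  forall U, open U -> measurable (f @^-1` U).
Proof.
split=> [mf U oU|mf].
  by rewrite -[X in measurable X]setTI; apply: mf => //; exact: open_measurable.
apply: (measurability _ (RGenOpens.measurableE R)).
by move=> _ [_ [x [y ->]] <-]; rewrite setTI; apply: mf; exact: interval_open.
Qed.

Lemma measurable_borelD (B : sepBanachType R) (f g : X -> B) :
  measurable_fun [set: X] (f : X -> borel B) ->
  measurable_fun [set: X] (g : X -> borel B) ->
  measurable_fun [set: X] ((fun x => f x + g x) : X -> borel B).
Proof.
move=> mf mg; apply: measurable_borel.
apply: (@measurable_comp2 _ _ _ _ _ (fun z : B * B => z.1 + z.2)).
- exact: second_countable_sepBanach.
- exact: second_countable_sepBanach.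
- exact: add_continuous.
- by move=> U; exact: borel_open.
- by move=> U; exact: borel_open.
Qed.

Lemma measurable_borelZ (B : sepBanachType R) (f : X -> R) (g : X -> B) :
  measurable_fun [set: X] f ->
  measurable_fun [set: X] (g : X -> borel B) ->
  measurable_fun [set: X] ((fun x => f x *: g x) : X -> borel B).
Proof.
move=> mf mg; apply: measurable_borel.
apply: (@measurable_comp2 _ _ _ _ _ (fun z : R^o * B => z.1 *: z.2)).
- exact: second_countable_R.
- exact: second_countable_sepBanach.
- exact: scale_continuous.
- exact/measurable_openP.
- by move=> U; exact: borel_open.
Qed.

Lemma measurable_borel_norm (B : sepBanachType R) (f : X -> B) :
  measurable_fun [set: X] (f : X -> borel B) ->
  measurable_fun [set: X] (fun x => `|f x|).
Proof.
move=> mf; apply/measurable_openP => U oU.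
apply: (@borel_open _ _ _ f ((fun y : B => `|y|) @^-1` U)) => //.
by apply: open_comp => // y _; exact: norm_continuous.
Qed.

End normed_borel.

Section sections.
Context {d : measure_display} {X : measurableType d} {R : realType}.
Context {B : sepBanachType R}.
Variable E : bundle X B.

HB.instance Definition _ := gen_eqMixin (section E).
HB.instance Definition _ := gen_choiceMixin (section E).

Definition sec0 : section E :=
  @Section _ _ _ _ E (fun=> 0) (@measurable_cst _ _ X (borel B) setT (0 : B)) (fun x => Gr0 (E x)).

Definition sec_add (s t : section E) : section E.
Proof.
apply: (@Section _ _ _ _ E (fun x => s x + t x)).
  by apply: measurable_borelD; exact: measurable_section.
by move=> x; rewrite -[s x]scale1r; apply: GrP; exact: section_in.
Defined.

Definition sec_scale (f : {mfun X >-> R}) (s : section E) : section E.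
Proof.
apply: (@Section _ _ _ _ E (fun x => f x *: s x)).
  by apply: measurable_borelZ => //; exact: measurable_section.
move=> x; rewrite -[_ *: _]addr0.
by apply: GrP; [exact: section_in|exact: Gr0].
Defined.

Definition sec_norm (s : section E) : {mfun X >-> R} :=
  mfun_Sub (mem_set (measurable_borel_norm (measurable_section s))).

End sections.

Section Gamma.
Context {d : measure_display} {X : measurableType d} {R : realType}.
Context {B : sepBanachType R}.
Variables (mu : {measure set X -> \bar R}) (E : bundle X B).

Definition sec_ae_eq (s t : section E) := `[< \forall x \ae mu, s x = t x >].

Fact sec_ae_eq_refl : reflexive sec_ae_eq.
Proof. by move=> s; apply/asboolP/aeW. Qed.

Fact sec_ae_eq_sym : symmetric sec_ae_eq.
Proof.
by move=> s t; apply/idP/idP => /asboolP h; apply/asboolP; apply: filterS h.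
Qed.

Fact sec_ae_eq_trans : transitive sec_ae_eq.
Proof.
move=> t s u /asboolP st /asboolP tu; apply/asboolP.
by apply: filterS2 st tu => x -> ->.
Qed.

Canonical sec_ae_eq_equiv :=
  EquivRel sec_ae_eq sec_ae_eq_refl sec_ae_eq_sym sec_ae_eq_trans.

Definition Gamma : Type := {eq_quot sec_ae_eq}.
HB.instance Definition _ := Choice.on Gamma.
HB.instance Definition _ := EqQuotient.on Gamma.
Definition Gamma_fun (s : Gamma) : X -> B := repr s.
Coercion Gamma_fun : Gamma >-> Funclass.

Definition secclass (s : section E) : Gamma := \pi_Gamma s.

Lemma secclassE (s : section E) : \forall x \ae mu, secclass s x = s x.
Proof.
by have /eqmodP/asboolP : repr (secclass s) = s %[mod Gamma] by rewrite reprK.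
Qed.

Lemma GammaP (s t : Gamma) : (\forall x \ae mu, s x = t x) -> s = t.
Proof.
by move=> st; rewrite -[s]reprK -[t]reprK; apply/eqmodP/asboolP.
Qed.

Definition Gamma_add (s t : Gamma) : Gamma := secclass (sec_add (repr s) (repr t)).
Definition Gamma_scale (f : L0 mu) (s : Gamma) : Gamma :=
  secclass (sec_scale (repr f) (repr s)).
Definition Gamma_opp (s : Gamma) : Gamma :=
  secclass (sec_scale (-1) (repr s)).
Definition Gamma_norm (s : Gamma) : L0 mu := L0class mu (sec_norm (repr s)).

Fact Gamma_addE s t : \forall x \ae mu, Gamma_add s t x = s x + t x.
Proof. exact: secclassE. Qed.
Fact Gamma_scaleE f s : \forall x \ae mu, Gamma_scale f s x = f x *: s x.
Proof. exact: secclassE. Qed.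
Fact Gamma_oppE s : \forall x \ae mu, Gamma_opp s x = - s x.
Proof.
by apply: filterS (secclassE (sec_scale (-1) (repr s))) => x /= ->; rewrite scaleN1r.
Qed.
Fact Gamma_normE s : \forall x \ae mu, Gamma_norm s x = `|s x|.
Proof. exact: L0classE. Qed.
Fact Gamma_0E : \forall x \ae mu, secclass (sec0 E) x = 0.
Proof. exact: secclassE. Qed.

Fact Gamma_addA : associative Gamma_add.
Proof.
move=> f g h; apply: GammaP; near=> x.
rewrite (near (Gamma_addE f (Gamma_add g h)) x)//.
rewrite (near (Gamma_addE g h) x)//.
rewrite (near (Gamma_addE (Gamma_add f g) h) x)//.
by rewrite (near (Gamma_addE f g) x)// addrA.
Unshelve. all: by end_near. Qed.

Fact Gamma_addC : commutative Gamma_add.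
Proof.
move=> f g; apply: GammaP; near=> x.
rewrite (near (Gamma_addE f g) x)// (near (Gamma_addE g f) x)//.
by rewrite addrC.
Unshelve. all: by end_near. Qed.

Fact Gamma_add0 : left_id (secclass (sec0 E)) Gamma_add.
Proof.
move=> f; apply: GammaP; near=> x.
rewrite (near (Gamma_addE (secclass (sec0 E)) f) x)//.
by rewrite (near Gamma_0E x)//= add0r.
Unshelve. all: by end_near. Qed.

Fact Gamma_addN : left_inverse (secclass (sec0 E)) Gamma_opp Gamma_add.
Proof.
move=> f; apply: GammaP; near=> x.
rewrite (near (Gamma_addE (Gamma_opp f) f) x)//.
by rewrite (near (Gamma_oppE f) x)// (near Gamma_0E x)//= addNr.
Unshelve. all: by end_near. Qed.

HB.instance Definition _ :=
  GRing.isZmodule.Build Gamma Gamma_addA Gamma_addC Gamma_add0 Gamma_addN.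

Lemma GammaD (s t : Gamma) : \forall x \ae mu, (s + t : Gamma) x = s x + t x.
Proof. exact: Gamma_addE. Qed.
Lemma GammaN (s : Gamma) : \forall x \ae mu, (- s : Gamma) x = - s x.
Proof. exact: Gamma_oppE. Qed.
Lemma Gamma0 : \forall x \ae mu, (0 : Gamma) x = 0.
Proof. exact: Gamma_0E. Qed.

Fact Gamma_scaleA f g s :
  Gamma_scale f (Gamma_scale g s) = Gamma_scale (f * g) s.
Proof.
apply: GammaP; near=> x.
rewrite (near (Gamma_scaleE f (Gamma_scale g s)) x)//.
rewrite (near (Gamma_scaleE g s) x)// (near (Gamma_scaleE (f * g) s) x)//.
by rewrite (near (L0M f g) x)// scalerA.
Unshelve. all: by end_near. Qed.

Fact Gamma_scale1 : left_id 1 Gamma_scale.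
Proof.
move=> s; apply: GammaP; near=> x.
by rewrite (near (Gamma_scaleE 1 s) x)// (near (L01 mu) x)// scale1r.
Unshelve. all: by end_near. Qed.

Fact Gamma_scaleDr : right_distributive Gamma_scale +%R.
Proof.
move=> f s t; apply: GammaP; near=> x.
rewrite (near (Gamma_scaleE f (s + t)) x)// (near (GammaD s t) x)//.
rewrite (near (GammaD (Gamma_scale f s) (Gamma_scale f t)) x)//.
rewrite (near (Gamma_scaleE f s) x)// (near (Gamma_scaleE f t) x)//.
by rewrite scalerDr.
Unshelve. all: by end_near. Qed.

Fact Gamma_scaleDl s : {morph Gamma_scale^~ s : f g / f + g}.
Proof.
move=> f g; apply: GammaP; near=> x.
rewrite (near (Gamma_scaleE (f + g) s) x)// (near (L0D f g) x)//.
rewrite (near (GammaD (Gamma_scale f s) (Gamma_scale g s)) x)//.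
rewrite (near (Gamma_scaleE f s) x)// (near (Gamma_scaleE g s) x)//.
by rewrite scalerDl.
Unshelve. all: by end_near. Qed.

HB.instance Definition _ := GRing.Zmodule_isLmodule.Build (L0 mu) Gamma
  Gamma_scaleA Gamma_scale1 Gamma_scaleDr Gamma_scaleDl.

Lemma GammaZ (f : L0 mu) (s : Gamma) :
  \forall x \ae mu, (f *: s : Gamma) x = f x *: s x.
Proof. exact: Gamma_scaleE. Qed.

Lemma GammaB (s t : Gamma) : \forall x \ae mu, (s - t : Gamma) x = s x - t x.
Proof.
near=> x; rewrite (near (GammaD s (- t)) x)//.
by rewrite (near (GammaN t) x).
Unshelve. all: by end_near. Qed.

Fact Gamma_norm_ge0 s : \forall x \ae mu, 0 <= Gamma_norm s x.
Proof. by apply: filterS (Gamma_normE s) => x ->. Qed.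

Fact Gamma_norm_eq0 s : Gamma_norm s = 0 <-> s = 0.
Proof.
split=> [s0|->].
  apply: GammaP; near=> x; apply/eqP; rewrite (near Gamma0 x)//.
  rewrite -normr_eq0 -(near (Gamma_normE s) x)//.
  by rewrite s0 (near (L00 mu) x).
apply: L0P; near=> x; rewrite (near (Gamma_normE 0) x)//.
by rewrite (near Gamma0 x)// (near (L00 mu) x)// normr0.
Unshelve. all: by end_near. Qed.

Fact Gamma_normD s t : \forall x \ae mu,
  Gamma_norm (s + t) x <= Gamma_norm s x + Gamma_norm t x.
Proof.
near=> x; rewrite (near (Gamma_normE (s + t)) x)// (near (GammaD s t) x)//.
rewrite (near (Gamma_normE s) x)// (near (Gamma_normE t) x)//.
exact: ler_normD.
Unshelve. all: by end_near. Qed.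

Fact Gamma_normZ (f : L0 mu) s : \forall x \ae mu,
  Gamma_norm (f *: s) x = `|f x| * Gamma_norm s x.
Proof.
near=> x; rewrite (near (Gamma_normE (f *: s)) x)// (near (GammaZ f s) x)//.
by rewrite (near (Gamma_normE s) x)// normrZ.
Unshelve. all: by end_near. Qed.

End Gamma.

Section Gamma_complete.
Context {d : measure_display} {X : measurableType d} {R : realType}.
Context {B : sepBanachType R} {mu : {measure set X -> \bar R}}.
Variables (m' : equivProbability mu) (E : bundle X B).

Fact ae_eprob (P : X -> Prop) : (\forall x \ae mu, P x) -> \forall x \ae m', P x.
Proof.
move=> [N [mN N0 PN]]; exists N; split => //.
by have /null_content_dominatesP := @eprob_ll _ _ _ _ m'; exact.
Qed.

Fact ae_of_eprob (P : X -> Prop) :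
  (\forall x \ae m', P x) -> \forall x \ae mu, P x.
Proof.
move=> [N [mN N0 PN]]; exists N; split => //.
by have /null_content_dominatesP := @ll_eprob _ _ _ _ m'; exact.
Qed.

Fact eprob_le1 : (m' [set: X] <= 1)%E.
Proof.
have [mu0|/eprob_setT -> //] := eqVneq (mu [set: X]) 0%E.
have /null_content_dominatesP := @eprob_ll _ _ _ _ m'.
by move=> /(_ _ measurableT mu0) ->.
Qed.

Let h (f g : X -> B) x : R := Num.min `|f x - g x| 1.

Let h_ge0 f g x : 0 <= h f g x.
Proof. by rewrite le_min normr_ge0 ler01. Qed.

Let h_le1 f g x : h f g x <= 1.
Proof. by rewrite ge_min lexx orbT. Qed.

Let mh (f g : section E) : measurable_fun [set: X] (fun x => (h f g x)%:E).
Proof.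
apply/measurable_EFinP; apply: measurable_minr; last exact: measurable_cst.
have := measurable_borel_norm (measurable_section (sec_add f (sec_scale (-1) g))).
by apply: eq_measurable_fun => x _ /=; rewrite scaleN1r.
Qed.

Let D (f g : X -> B) : \bar R := (\int[m']_x (h f g x)%:E)%E.

Let D_ge0 f g : (0 <= D f g)%E.
Proof. by apply: integral_ge0 => x _; rewrite lee_fin. Qed.

Let D_fin (f g : section E) : D f g \is a fin_num.
Proof.
rewrite ge0_fin_numE// (@le_lt_trans _ _ (\int[m']_x (cst 1%E) x)%E)//.
  by apply: ge0_le_integral => //[x _|x _]; rewrite lee_fin.
by rewrite integral_cst// mul1e (le_lt_trans eprob_le1)// ltry.
Qed.

Let L0dist_Gamma (s t : Gamma mu E) :
  L0dist m' (Gamma_norm (s - t)) 0 = fine (D s t).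
Proof.
congr fine; apply: ge0_ae_eq_integral => //=.
- apply/measurable_EFinP; apply: measurable_minr; last exact: measurable_cst.
  apply: measurableT_comp => //.
  by apply: measurable_funB; exact: measurable_L0.
- exact: mh.
- by move=> x _; rewrite lee_fin le_min normr_ge0 ler01.
have : \forall x \ae mu, Num.min `|Gamma_norm (s - t) x - (0 : L0 mu) x| 1 = h s t x.
  near=> x; rewrite /h.
  rewrite (near (L00 mu) x)// subr0 (near (Gamma_normE (s - t)) x)//.
  by rewrite (near (GammaB s t) x)// normr_id.
by move=> /ae_eprob; apply: filterS => x -> _.
Unshelve. all: by end_near. Qed.

Let markov (f g : section E) (r : R) : 0 < r ->
  (r%:E * m' [set x | (r <= h f g x)%R] <= D f g)%E.
Proof.
move=> r0; have := @le_integral_comp_abse _ _ _ m' _ measurableT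
  (fun x => (h f g x)%:E) r id (@measurable_id _ _ _) (fun _ => id)
  (fun x y _ _ => id) (mh f g) r0.
rewrite setTI; congr (_ * m' _ <= _)%E.
  by apply/seteqP; split=> x /=; rewrite lee_fin ger0_norm.
by apply: eq_integral => x _; rewrite gee0_abs// lee_fin.
Qed.

Fact Gamma_complete (u : nat -> Gamma mu E) :
  (forall e : R, 0 < e -> exists N, forall i j, (N <= i)%N -> (N <= j)%N ->
    L0dist m' (Gamma_norm (u i - u j)) 0 < e) ->
  exists v, L0dist m' (Gamma_norm (u n - v)) 0 @[n --> \oo] --> (0 : R).
Proof.
move=> uC.
have {}uC e : 0 < e -> exists N, forall i j, (N <= i)%N -> (N <= j)%N ->
    (D (u i) (u j) < e%:E)%E.
  move=> /uC[N uN]; exists N => i j Ni Nj; have := uN _ _ Ni Nj.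
  by rewrite L0dist_Gamma -lte_fin fineK// D_fin.
pose r k : R := 2^-1 ^+ k.
have r0 k : 0 < r k by rewrite exprn_gt0// invr_gt0.
have /choice[N uN] k := uC _ (mulr_gt0 (r0 k) (r0 k)).
pose n k := (\sum_(i < k.+1) (N i).+1)%N.
have kn k : (k <= n k)%N.
  elim: k => // k ih; rewrite /n big_ord_recr/= -/(n k) addnS ltnS.
  exact: leq_trans (leq_addr _ _).
have nN k : (N k <= n k)%N by rewrite /n big_ord_recr/= (leq_trans (leqnSn _)) ?leq_addl.
have nS k : (n k <= n k.+1)%N by rewrite [leqRHS]/n big_ord_recr/= leq_addr.
pose s k : section E := repr (u (n k)).
pose F k := [set x | r k <= h (s k.+1) (s k) x].
have mF k : measurable (F k).
  have /measurable_EFinP mhk := mh (s k.+1) (s k).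
  have := mhk measurableT _ (measurable_itv `[r k, +oo[%R).
  rewrite setTI; congr measurable.
  by apply/seteqP; split=> x /=; rewrite in_itv/= andbT.
have m'F k : (m' (F k) <= (r k)%:E)%E.
  rewrite -(@lee_pmul2l _ (r k)%:E)// ?lte_fin//.
  apply: (le_trans (markov _ _ (r0 k))); rewrite -EFinM; apply/ltW/uN => //.
  exact: leq_trans (nN k) (nS k).
have N0 : m' (lim_sup_set F) = 0%E.
  apply: lim_sup_set_cvg0 => //.
  apply: (@le_lt_trans _ _ (\sum_(k <oo) (2 / (2 ^ (k + 1))%:R : R)%:E)%E).
    apply: lee_nneseries => // k _; apply: (le_trans (m'F k)).
    rewrite lee_fin /r exprVn addn1 expnS natrM invfM mulrA divff// mul1r.
    by rewrite natrX.
  by have /cvg_lim -> // := @cvg_geometric_eseries_half R 2 0; rewrite ltry.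
have mNF : measurable (lim_sup_set F).
  by apply: bigcapT_measurable => k; exact: bigcup_measurable.
pose f k x : B := \1_(~` lim_sup_set F) x *: s k x.
have fcvg x : cvgn (f ^~ x).
  have [xN|xN] := pselect (lim_sup_set F x).
    rewrite (_ : f ^~ x = cst 0); first exact: is_cvg_cst.
    apply/funext => k; rewrite /f indicE memNset ?scale0r//.
  have -> : f ^~ x = s ^~ x.
    by apply/funext => k; rewrite /f indicE mem_set ?scale1r.
  have [K KF] : exists K, forall j, (K <= j)%N -> ~ F j x.
    apply: contra_notP xN => /forallNP nK k _.
    by have /existsNP[j /not_implyP[kj /contrapT Fj]] := nK k; exists j.
  pose v j := s (K + j)%N x.
  suff /cvg_ex[l vl] : cvgn v.
    apply/cvg_ex; exists l; rewrite -(cvg_shiftn K).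
    by under eq_fun do rewrite addnC.
  have -> : v = (fun j => v 0%N + series (telescope v) j).
    by apply/funext => j; exact: eq_sum_telescope.
  apply: is_cvgD; first exact: is_cvg_cst.
  apply: normed_cvg; apply: (@series_le_cvg _ _ (geometric 1 2^-1)) => //=.
  - move=> j; rewrite /geometric /telescope /v/= mul1r addnS.
    have /negP := KF (K + j)%N (leq_addr _ _); rewrite -ltNge.
    rewrite /h gt_min => /orP[|].
      move=> /ltW/le_trans; apply.
      by rewrite /r exprD ler_piMl ?exprn_ge0 ?invr_ge0// exprn_ile1// invf_le1// ler1n.
    by rewrite ltNge /r exprn_ile1// invf_le1// ler1n.
  - by apply: is_cvg_geometric_series; rewrite ger0_norm// invf_lt1// ltr1n.
pose g x := limn (f ^~ x).
have fg x : f k x @[k --> \oo] --> g x by exact: fcvg.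
have mf k U : open U -> measurable (f k @^-1` U).
  apply: borel_open; apply: measurable_borelZ; last exact: measurable_section.
  by apply: measurable_indic; exact: measurableC.
have mg : measurable_fun [set: X] (g : X -> borel B).
  by apply: measurable_borel; exact: (measurable_borel_lim mf fg).
have gE x : (E x : set B) (g x).
  have cE := @Gr_closed _ _ (E x).
  refine (@closed_cvg _ _ _ _ (f ^~ x) _ cE _ _ (fg x)).
  apply: nearW => k; rewrite /f -[_ *: _]addr0.
  by apply: GrP; [exact: section_in|exact: Gr0].
exists (secclass mu (Section mg gE)).
apply/cvgrPdist_le => /= e e0; have [K uK] := uC _ e0.
exists K => // i /= Ki; rewrite sub0r normrN.
rewrite ger0_norm ?L0dist_Gamma ?fine_ge0// -lee_fin fineK; last exact: D_fin.
have -> : D (u i) (secclass mu (Section mg gE)) = D (u i) g.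
  apply: ge0_ae_eq_integral => //=; try by move=> x _; rewrite lee_fin.
  - exact: mh.
  - exact: (mh (repr (u i)) (Section mg gE)).
  by apply: filterS (ae_eprob (secclassE mu (Section mg gE))) => x + _; rewrite /h => ->.
have [|||||_ _ +] := @dominated_convergence _ _ _ m' _ measurableT
   (fun k x => (h (u i) (s k) x)%:E) (fun x => (h (u i) g x)%:E) (cst 1%E).
- by move=> k; exact: mh.
- exact: (mh (repr (u i)) (Section mg gE)).
- have : \forall x \ae m', ~ lim_sup_set F x.
    by exists (lim_sup_set F); split=> // x /contrapT.
  apply: filterS => x xN _; apply: cvg_EFin; first exact: nearW.
  have sg : s k x @[k --> \oo] --> g x.
    rewrite (_ : s ^~ x = f ^~ x); first exact: fg.
    by apply/funext => k; rewrite /f indicE mem_set ?scale1r.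
  have usg : `|repr (u i) x - s k x| @[k --> \oo] --> `|repr (u i) x - g x|.
    by apply: cvg_norm; apply: cvgB => //; exact: cvg_cst.
  rewrite /h minr_absE; under eq_fun do rewrite minr_absE.
  apply: cvgM; last exact: cvg_cst.
  apply: cvgB; first by apply: cvgD => //; exact: cvg_cst.
  by apply: cvg_norm; apply: cvgB => //; exact: cvg_cst.
- apply/integrableP; split; first exact: measurable_cst.
  under eq_integral do rewrite abse1.
  by rewrite integral_cst// mul1e (le_lt_trans eprob_le1)// ltry.
- by apply: aeW => x k _ /=; rewrite lee_fin ger0_norm.
move=> Dc; rewrite /D -(cvg_lim _ Dc)//; apply: lime_le; first exact: cvgP Dc.
exists K => // k /= Kk; apply/ltW/uK => //; exact: leq_trans (kn k).
Qed.

HB.instance Definition _ := @Lmodule_isNormedL0Module.Build d X R mu m'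
  (Gamma mu E) (@Gamma_norm _ _ _ _ mu E) (@Gamma_norm_ge0 _ _ _ _ mu E)
  (@Gamma_norm_eq0 _ _ _ _ mu E) (@Gamma_normD _ _ _ _ mu E)
  (@Gamma_normZ _ _ _ _ mu E) Gamma_complete.

End Gamma_complete.

(* Main.v *)
Require Import Defs.
From HB Require Import structures.
From mathcomp Require Import all_boot all_order all_algebra.
From mathcomp Require Import all_classical all_reals all_analysis.
From mathcomp Require Import measurable_realfun lra.

Set Implicit Arguments.
Unset Strict Implicit.
Unset Printing Implicit Defensive.
Import Order.TTheory GRing.Theory Num.Theory.
Import numFieldNormedType.Exports.
Local Open Scope classical_set_scope.
Local Open Scope ring_scope.

(* Let [w_n] be generators of the module with [|w_n| <= 2^-n]. For almost every
   [x], [p_x v = |sum_n v_n w_n|(x)] is a seminorm on real polynomials [v], and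
   everything reduces to finding linear maps [J_x : {poly R} -> B], measurable
   in [x], with [`|J_x v| = p_x v]: the bundle is then the closed range of [J_x]
   and ['X^n] gives the section corresponding to [w_n].
   Measurable selection theorems are avoided as follows. Since [p_x ('X^n)] is
   small for large [n], the seminorms [p_x] form a totally bounded family, so [X]
   is cut into successively finer countable measurable partitions on whose cells
   [p_x] is almost constant. The cells form a countable tree; taking the seminorm
   of one point in each cell, all these seminormed spaces are glued along the
   edges of the tree into a single separable space, in which the copies of
   ['X^n] at a cell and at its parent are close. Embed this one space in [B] by
   universality: along the branch of [x] the images of ['X^n] converge to
   [J_x ('X^n)]. *)

(** * Seminorms and completions *)

(** Embedding each space [({poly R}, p_x)] in [B] separately would give no measurability in [x]:
    universality yields some isometry for each space and says nothing about how two of them compare.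
    Inside one separable space containing countably many copies at prescribed small distances, a
    single isometry serves all of them and keeps these distances. Gluing a seminorm [q] to a
    seminorm [q'] at cost [c] keeps both isometric as soon as [|q - q'| <= c]; along a tree this
    condition is local, since each new copy is compared with one earlier copy only. Polynomials
    stand for finitely supported sequences, and rational ones for a countable dense subset on which
    pointwise norms, defined almost everywhere, can be handled all at once. The isomorphism comes
    from pairing combinations of the [w_n] with combinations of the sections having the same
    coefficients in [L0 mu]: the pairing preserves pointwise norms, is dense on both sides, and its
    closure is the graph of a bijection. *)

Record seminorm (R : realType) (V : lmodType R) := Seminorm {
  snorm :> V -> R ;
  snormD : forall u v, snorm (u + v) <= snorm u + snorm v ;
  snormZ : forall a v, snorm (a *: v) = `|a| * snorm v }.

Section seminorm_theory.
Context {R : realType} {V : lmodType R} (N : seminorm V).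

Lemma snorm0 : N 0 = 0.
Proof. by rewrite -(scale0r 0) snormZ normr0 mul0r. Qed.

Lemma snormN v : N (- v) = N v.
Proof. by rewrite -scaleN1r snormZ normrN1 mul1r. Qed.

Lemma snorm_ge0 v : 0 <= N v.
Proof.
have := snormD N v (- v); rewrite subrr snorm0 snormN -mulr2n.
by rewrite pmulrn_lge0.
Qed.

Lemma snormBC u v : N (u - v) = N (v - u).
Proof. by rewrite -opprB snormN. Qed.

Lemma snorm_trans w u v : N (u - v) <= N (u - w) + N (w - v).
Proof. by rewrite (le_trans _ (snormD _ _ _))// addrA subrK. Qed.

Lemma snorm_dist u v : `|N u - N v| <= N (u - v).
Proof.
rewrite ler_norml lerBlDr -[X in _ && (N X <= _)](subrK v) snormD andbT.
by rewrite lerNl opprB lerBlDr -{1}[v](subrK u) snormBC snormD.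
Qed.

Lemma snorm_sum (I : Type) (r : seq I) (F : I -> V) :
  N (\sum_(i <- r) F i) <= \sum_(i <- r) N (F i).
Proof.
elim/big_ind2: _ => [|x x' y y' xy xy'|//]; first by rewrite snorm0.
exact: le_trans (snormD _ _ _) (lerD xy xy').
Qed.

End seminorm_theory.

(** * Completion of a seminormed space *)

Section completion.
Local Open Scope quotient_scope.
Context {R : realType} {Z : lmodType R} (N : seminorm Z).

Record cseq := CSeq {
  cseq_fun :> nat -> Z ;
  cseqP : forall e : R, 0 < e -> exists K, forall i j, (K <= i)%N -> (K <= j)%N ->
    N (cseq_fun i - cseq_fun j) < e }.

HB.instance Definition _ := gen_eqMixin cseq.
HB.instance Definition _ := gen_choiceMixin cseq.

Lemma cseq_ext (u v : cseq) : (forall n, u n = v n) -> u = v.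
Proof.
case: u v => [u uP] [v vP] /= /funext uv; subst v.
by congr CSeq; exact: Prop_irrelevance.
Qed.

Definition cseq_cst (z : Z) : cseq.
Proof. by apply: (@CSeq (fun=> z)) => e e0; exists 0%N => *; rewrite subrr snorm0. Defined.

Definition cseq_add (u v : cseq) : cseq.
Proof.
apply: (@CSeq (fun n => u n + v n)) => e e0.
have e20 : 0 < e / 2 by rewrite divr_gt0.
have [K Ku] := cseqP u e20.
have [L Lv] := cseqP v e20.
exists (maxn K L) => i j; rewrite !geq_max => /andP[Ki Li] /andP[Kj Lj].
rewrite opprD addrACA (le_lt_trans (snormD _ _ _))// (splitr e).
by apply: ltrD; [exact: Ku|exact: Lv].
Defined.

Definition cseq_scale (a : R) (u : cseq) : cseq.
Proof.
apply: (@CSeq (fun n => a *: u n)) => e e0.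
have a0 : 0 < `|a| + 1 by rewrite ltr_wpDl.
have [K Ku] := cseqP u (divr_gt0 e0 a0).
exists K => i j Ki Kj; rewrite -scalerBr snormZ.
have := Ku _ _ Ki Kj; rewrite ltr_pdivlMr//; apply: le_lt_trans.
by rewrite mulrC ler_wpM2l ?snorm_ge0// lerDl.
Defined.

(** Identifying sequences whose seminorm distance tends to 0 also kills the vectors of seminorm 0,
    so that the quotient carries a norm although [N] is only a seminorm. *)
Definition cseq_eqv (u v : cseq) := `[< N (u n - v n) @[n --> \oo] --> (0 : R) >].

Lemma cseq_eqvP (u v : cseq) : reflect
  (forall e : R, 0 < e -> \forall n \near \oo, N (u n - v n) < e) (cseq_eqv u v).
Proof.
apply: (iffP (asboolP _)) => [uv e e0|uv].
  move/cvgrPdist_lt : uv => /(_ _ e0); apply: filterS => n.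
  by rewrite sub0r normrN ger0_norm ?snorm_ge0.
apply/cvgrPdist_lt => e /uv; apply: filterS => n.
by rewrite sub0r normrN ger0_norm ?snorm_ge0.
Qed.

Fact cseq_eqv_refl : reflexive cseq_eqv.
Proof. by move=> u; apply/cseq_eqvP => e e0; apply: nearW => n; rewrite subrr snorm0. Qed.

Fact cseq_eqv_sym : symmetric cseq_eqv.
Proof.
by move=> u v; apply/cseq_eqvP/cseq_eqvP => uv e /uv; apply: filterS => n;
  rewrite snormBC.
Qed.

Fact cseq_eqv_trans : transitive cseq_eqv.
Proof.
move=> v u w /cseq_eqvP uv /cseq_eqvP vw; apply/cseq_eqvP => e e0.
have e20 : 0 < e / 2 by rewrite divr_gt0.
apply: filterS2 (uv _ e20) (vw _ e20) => n un vn.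
by rewrite (le_lt_trans (snorm_trans _ (v n) _ _))// (splitr e) ltrD.
Qed.

Canonical cseq_eqv_equiv :=
  EquivRel cseq_eqv cseq_eqv_refl cseq_eqv_sym cseq_eqv_trans.

Definition completion : Type := {eq_quot cseq_eqv}.
HB.instance Definition _ := Choice.on completion.
HB.instance Definition _ := EqQuotient.on completion.

Definition lim_class (u : cseq) : completion := \pi_completion u.

Lemma lim_classP (u v : cseq) : cseq_eqv u v -> lim_class u = lim_class v.
Proof. by move=> uv; apply/eqmodP. Qed.

Lemma cseq_eqv_repr (u : cseq) : cseq_eqv (repr (lim_class u)) u.
Proof. by apply/eqmodP; rewrite reprK. Qed.

Definition completion_add (x y : completion) := lim_class (cseq_add (repr x) (repr y)).
Definition completion_scale a (x : completion) := lim_class (cseq_scale a (repr x)).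
Definition completion_opp (x : completion) := completion_scale (-1) x.

Lemma lim_classD (u v : cseq) :
  completion_add (lim_class u) (lim_class v) = lim_class (cseq_add u v).
Proof.
apply: lim_classP; apply/cseq_eqvP => e e0.
have e20 : 0 < e / 2 by rewrite divr_gt0.
have /cseq_eqvP/(_ _ e20) ue := cseq_eqv_repr u.
have /cseq_eqvP/(_ _ e20) ve := cseq_eqv_repr v.
apply: filterS2 ue ve => n un vn /=; rewrite opprD addrACA.
by rewrite (le_lt_trans (snormD _ _ _))// (splitr e) ltrD.
Qed.

Lemma lim_classZ a (u : cseq) :
  completion_scale a (lim_class u) = lim_class (cseq_scale a u).
Proof.
apply: lim_classP; apply/cseq_eqvP => e e0.
have a0 : 0 < `|a| + 1 by rewrite ltr_wpDl.
have /cseq_eqvP/(_ _ (divr_gt0 e0 a0)) := cseq_eqv_repr u.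
apply: filterS => n /=; rewrite -scalerBr snormZ ltr_pdivlMr//; apply: le_lt_trans.
by rewrite mulrC ler_wpM2l ?snorm_ge0// lerDl.
Qed.

Lemma completionW (P : completion -> Prop) :
  (forall u, P (lim_class u)) -> forall x, P x.
Proof. by move=> Pu x; rewrite -[x]reprK; exact: Pu. Qed.

Fact completion_addA : associative completion_add.
Proof.
elim/completionW => u; elim/completionW => v; elim/completionW => w.
by rewrite !lim_classD; congr lim_class; apply: cseq_ext => n /=; rewrite addrA.
Qed.

Fact completion_addC : commutative completion_add.
Proof.
elim/completionW => u; elim/completionW => v.
by rewrite !lim_classD; congr lim_class; apply: cseq_ext => n /=; rewrite addrC.
Qed.

Fact completion_add0 : left_id (lim_class (cseq_cst 0)) completion_add.
Proof.
elim/completionW => u.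
by rewrite !lim_classD; congr lim_class; apply: cseq_ext => n /=; rewrite add0r.
Qed.

Fact completion_addN :
  left_inverse (lim_class (cseq_cst 0)) completion_opp completion_add.
Proof.
elim/completionW => u; rewrite /completion_opp lim_classZ lim_classD.
by congr lim_class; apply: cseq_ext => n /=; rewrite scaleN1r addNr.
Qed.

HB.instance Definition _ := GRing.isZmodule.Build completion
  completion_addA completion_addC completion_add0 completion_addN.

Fact completion_scaleA a b x :
  completion_scale a (completion_scale b x) = completion_scale (a * b) x.
Proof.
elim/completionW: x => u; rewrite !lim_classZ.
by congr lim_class; apply: cseq_ext => n /=; rewrite scalerA.
Qed.

Fact completion_scale1 : left_id 1 completion_scale.
Proof.
elim/completionW => u; rewrite !lim_classZ.
by congr lim_class; apply: cseq_ext => n /=; rewrite scale1r.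
Qed.

Fact completion_scaleDr : right_distributive completion_scale +%R.
Proof.
move=> a; elim/completionW => u; elim/completionW => v.
rewrite /GRing.add/= !(lim_classZ, lim_classD).
by congr lim_class; apply: cseq_ext => n /=; rewrite scalerDr.
Qed.

Fact completion_scaleDl x : {morph completion_scale^~ x : a b / a + b}.
Proof.
move=> a b; elim/completionW: x => u.
rewrite [RHS]/GRing.add/= !(lim_classZ, lim_classD).
by congr lim_class; apply: cseq_ext => n /=; rewrite scalerDl.
Qed.

HB.instance Definition _ := GRing.Zmodule_isLmodule.Build R completion
  completion_scaleA completion_scale1 completion_scaleDr completion_scaleDl.

Lemma lim_class_add u v : lim_class u + lim_class v = lim_class (cseq_add u v).
Proof. exact: lim_classD. Qed.

Lemma lim_class_scale a u : a *: lim_class u = lim_class (cseq_scale a u).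
Proof. exact: lim_classZ. Qed.

Lemma is_cvg_snorm_cseq (u : cseq) : cvgn (fun n => N (u n)).
Proof.
apply: cauchy_cvg; apply: cauchy_exP => e e0.
have [K uK] := cseqP u e0; exists (N (u K)); exists K => // n /= Kn.
by apply: le_lt_trans (snorm_dist _ _ _) _; exact: uK.
Qed.

Definition completion_norm (x : completion) : R := limn (fun n => N (repr x n)).

Lemma completion_norm_cvg (u : cseq) :
  N (u n) @[n --> \oo] --> completion_norm (lim_class u).
Proof.
have ur : N (u n) - N (repr (lim_class u) n) @[n --> \oo] --> (0 : R).
  apply/cvgrPdist_lt => e e0.
  have /cseq_eqvP/(_ _ e0) := cseq_eqv_repr u; apply: filterS => n.
  by rewrite sub0r normrN snormBC; apply: le_lt_trans; exact: snorm_dist.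
rewrite (_ : (fun n => N (u n)) = (fun n => N (repr (lim_class u) n)) \+
    (fun n => N (u n) - N (repr (lim_class u) n))); last first.
  by apply/funext => n /=; rewrite addrC subrK.
by rewrite -[completion_norm _]addr0; apply: cvgD => //; exact: is_cvg_snorm_cseq.
Qed.

Fact completion_normD x y :
  completion_norm (x + y) <= completion_norm x + completion_norm y.
Proof.
elim/completionW: x => u; elim/completionW: y => v; rewrite lim_class_add.
have uv : N (u n) + N (v n) @[n --> \oo] -->
    completion_norm (lim_class u) + completion_norm (lim_class v).
  by apply: cvgD; exact: completion_norm_cvg.
apply: (ler_cvg_to (@completion_norm_cvg (cseq_add u v)) uv).
by apply: nearW => n /=; exact: snormD.
Qed.

Fact completion_normZ a x : completion_norm (a *: x) = `|a| * completion_norm x.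
Proof.
elim/completionW: x => u; rewrite lim_class_scale.
have au : N (a *: u n) @[n --> \oo] --> `|a| * completion_norm (lim_class u).
  by under eq_fun do rewrite snormZ; apply: cvgMl_tmp; exact: completion_norm_cvg.
exact: (cvg_unique _ (@completion_norm_cvg (cseq_scale a u)) au).
Qed.

Fact completion_norm_eq0 x : completion_norm x = 0 -> x = 0.
Proof.
elim/completionW: x => u u0; apply: lim_classP; apply/asboolP => /=.
by rewrite -u0; under eq_fun do rewrite subr0; exact: completion_norm_cvg.
Qed.

HB.instance Definition _ := Lmodule_isNormed.Build R completion
  completion_normD completion_normZ completion_norm_eq0.

Lemma norm_lim_class_cvg (u : cseq) : N (u n) @[n --> \oo] --> `|lim_class u|.
Proof. exact: completion_norm_cvg. Qed.

Definition completion_in z : completion := lim_class (cseq_cst z).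

Fact completion_in_is_linear : linear completion_in.
Proof.
move=> a u v; rewrite lim_class_scale lim_class_add.
by congr lim_class; exact: cseq_ext.
Qed.

HB.instance Definition _ :=
  GRing.isLinear.Build R Z completion *:%R completion_in completion_in_is_linear.

Lemma norm_completion_in z : `|completion_in z| = N z.
Proof.
have zN : N (cseq_cst z n) @[n --> \oo] --> N z by rewrite /=; exact: cvg_cst.
exact: (cvg_unique _ (@norm_lim_class_cvg (cseq_cst z)) zN).
Qed.

Lemma lim_class_approx (u : cseq) (e : R) : 0 < e ->
  \forall n \near \oo, `|lim_class u - completion_in (u n)| <= e.
Proof.
move=> e0; have [K uK] := cseqP u e0; exists K => // n /= Kn.
rewrite -[- _]scaleN1r lim_class_scale lim_class_add.
apply: (ler_cvg_to (@norm_lim_class_cvg _) (cvg_cst e)).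
by exists K => // m /= Km; rewrite scaleN1r; exact/ltW/uK.
Qed.

Lemma completion_in_dense (x : completion) (e : R) : 0 < e ->
  exists z, `|x - completion_in z| < e.
Proof.
move=> e0; elim/completionW: x => u.
have e20 : 0 < e / 2 by rewrite divr_gt0.
have [n _ /(_ _ (leqnn n)) un] := lim_class_approx u e20.
exists (u n); rewrite (le_lt_trans un)// ltr_pdivrMr// mulr_natr.
by rewrite mulr2n ltrDl.
Qed.

(** The filter [F] contains a ball of radius [1 / k.+1] around some [z k] of [Z]; any two of these
    balls meet, so [z] is Cauchy for [N] and its class is a limit of [F]. *)
Fact completion_complete (F : set_system completion) :
  ProperFilter F -> cauchy F -> cvg F.
Proof.
move=> FF /cauchyP Fc.
have /choice[z zF] k : exists z, F (ball (completion_in z) (k.+1%:R^-1 : R)).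
  have k0 : 0 < (k.+1%:R^-1 / 2 : R) by rewrite divr_gt0.
  have [x Fx] := Fc _ k0; have [z xz] := completion_in_dense x k0.
  exists z; apply: filterS Fx => y xy; rewrite (splitr k.+1%:R^-1).
  by apply: ball_triangle xy; rewrite -ball_normE/= distrC.
have zz i j : N (z i - z j) < i.+1%:R^-1 + j.+1%:R^-1.
  have [y [yi yj]] := filter_ex (filterI (zF i) (zF j)).
  rewrite -norm_completion_in linearB/=.
  by have := ball_triangle yi (ball_sym yj); rewrite -ball_normE.
have zC (e : R) : 0 < e -> exists K, forall i j, (K <= i)%N -> (K <= j)%N ->
    N (z i - z j) < e.
  move=> e0; have e20 : 0 < e / 2 by rewrite divr_gt0.
  have [K] := ltr_add_invr e20; rewrite add0r => Ke.
  exists K => i j Ki Kj; rewrite (lt_le_trans (zz i j))// (splitr e).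
  by apply: lerD; rewrite (le_trans _ (ltW Ke))// lef_pV2 ?posrE// ler_nat.
apply/cvg_ex; exists (lim_class (CSeq zC)); apply/cvg_ballP => e e0.
have e20 : 0 < e / 2 by rewrite divr_gt0.
have e40 : 0 < e / 2 / 2 by rewrite divr_gt0.
have [K] := ltr_add_invr e20; rewrite add0r => Ke.
have [L _ zL] := lim_class_approx (CSeq zC) e40.
have KLe : ((maxn K L).+1%:R^-1 : R) < e / 2.
  by rewrite (le_lt_trans _ Ke)// lef_pV2 ?posrE// ler_nat ltnS leq_maxl.
apply: filterS (zF (maxn K L)) => y zy; rewrite (splitr e).
apply: (@ball_triangle _ _ (completion_in (z (maxn K L)))); last exact: le_ball (ltW KLe) _ zy.
rewrite -ball_normE/=; apply: le_lt_trans (zL _ (leq_maxr _ _)) _.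
by rewrite ltr_pdivrMr// mulr_natr mulr2n ltrDl.
Qed.

HB.instance Definition _ := Uniform_isComplete.Build completion completion_complete.

End completion.

Lemma completion_separable (R : realType) (Z : lmodType R) (N : seminorm Z)
    (D : set Z) : countable D ->
  (forall z (e : R), 0 < e -> exists2 y, D y & N (z - y) < e) ->
  exists2 D' : set (completion N), countable D' & dense D'.
Proof.
move=> cD dD; exists (completion_in N @` D).
  exact: sub_countable (card_image_le _ _) cD.
move=> U [x Ux] oU; have /nbhs_ballP[e /= e0 eU] : nbhs x U by exact: open_nbhs_nbhs.
have e20 : 0 < e / 2 by rewrite divr_gt0.
have [z xz] := completion_in_dense x e20; have [y Dy zy] := dD z _ e20.
exists (completion_in N y); split; last by exists y.
apply: eU; rewrite (splitr e); apply: (@ball_triangle _ _ (completion_in N z)).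
  by rewrite -ball_normE.
by rewrite -ball_normE/= -linearB norm_completion_in.
Qed.

(** The completion carries universality, which is about Banach spaces, over to [(Z, N)]. The map [f]
    need not be injective: it vanishes where [N] does. *)
Lemma universal_seminorm (R : realType) (B : sepBanachType R) (Z : lmodType R)
    (N : seminorm Z) (D : set Z) : universal B -> countable D ->
  (forall z (e : R), 0 < e -> exists2 y, D y & N (z - y) < e) ->
  exists f : {linear Z -> B}, forall z, `|f z| = N z.
Proof.
move=> uB cD dD.
pose sep := isSeparable.Build (completion N) (completion_separable cD dD).
pose V : sepBanachType R := HB.pack (completion N) sep.
have [f fP] := uB V.
by exists (f \o completion_in N) => z /=; rewrite fP norm_completion_in.
Qed.

(** * Gluing seminormed spaces along a tree *)

Section seminorm_build.
Context {R : realType} {V : lmodType R}.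

(** The inequality for [a^-1] gives the converse one; when [a = 0], subadditivity alone gives
    [0 <= f 0]. *)
Lemma seminorm_scaleP (f : V -> R) :
  (forall u v, f (u + v) <= f u + f v) ->
  (forall a v, f (a *: v) <= `|a| * f v) ->
  forall a v, f (a *: v) = `|a| * f v.
Proof.
move=> fD fZ a v; apply/eqP; rewrite eq_le fZ/=.
have [->|a0] := eqVneq a 0.
  by rewrite normr0 mul0r scale0r; have := fD 0 0; rewrite addr0 lerDr.
rewrite -ler_pdivlMl ?normr_gt0// -normfV -{1}[v](scalerK a0).
exact: fZ.
Qed.

Definition seminorm_of (f : V -> R) (fD : forall u v, f (u + v) <= f u + f v)
    (fZ : forall a v, f (a *: v) <= `|a| * f v) : seminorm V :=
  Seminorm fD (seminorm_scaleP fD fZ).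

End seminorm_build.

Section inf_range.
Context {R : realType} {T : Type}.

Lemma ge_inf_range (F : T -> R) t : (forall s, 0 <= F s) -> inf (range F) <= F t.
Proof. by move=> F0; apply: ge_inf; [exists 0 => _ [s _ <-]|exists t]. Qed.

Lemma le_inf_range (F : T -> R) (t : T) (r : R) :
  (forall s, r <= F s) -> r <= inf (range F).
Proof. by move=> rF; apply: lb_le_inf; [exists (F t); exists t|move=> _ [s _ <-]]. Qed.

Lemma le_infD_range (F G : T -> R) (t : T) (r : R) :
  (forall s s', r <= F s + G s') -> r <= inf (range F) + inf (range G).
Proof.
move=> rFG; rewrite -lerBlDr; apply: (le_inf_range t) => s.
rewrite lerBlDr -lerBlDl; apply: (le_inf_range t) => s'.
by rewrite lerBlDl.
Qed.

End inf_range.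

(* Glues to the seminormed space [(Z, N)] a copy of [V] with seminorm [q], a
   new point [v] being moved to the old point [io v] at cost [c v]. *)
Section attach.
Context {R : realType} {V Z : lmodType R}.
Variables (N : seminorm Z) (q c : seminorm V).
Variables (io : {linear V -> Z}) (pi : {linear Z -> V}).

(** The new component [pi z] is split into [u], which is moved to the old space, and [pi z - u],
    which stays. In the intended use [N] does not see the component [pi z]. *)
Definition attach_cost z u := N (z + io u) + q (pi z - u) + c u.

Let attach_cost_ge0 z u : 0 <= attach_cost z u.
Proof. by rewrite !addr_ge0 ?snorm_ge0. Qed.

Definition attach_inf z := inf (range (attach_cost z)).

Let attach_le z u : attach_inf z <= attach_cost z u.
Proof. exact: ge_inf_range. Qed.

Fact attachD z z' : attach_inf (z + z') <= attach_inf z + attach_inf z'.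
Proof.
apply: (le_infD_range 0) => u u'; apply: (le_trans (attach_le _ (u + u'))).
have -> : attach_cost (z + z') (u + u') =
    N ((z + io u) + (z' + io u')) + q ((pi z - u) + (pi z' - u')) + c (u + u').
  by rewrite /attach_cost !linearD/= [in N _]addrACA [in q _]addrACA.
have := snormD N (z + io u) (z' + io u').
have := snormD q (pi z - u) (pi z' - u').
have := snormD c u u'; rewrite /attach_cost; lra.
Qed.

Fact attachZ a z : attach_inf (a *: z) <= `|a| * attach_inf z.
Proof.
have [->|a0] := eqVneq a 0.
  apply: (le_trans (attach_le _ 0)); rewrite normr0 mul0r scale0r /attach_cost.
  by rewrite !linear0 !addr0 !snorm0 !addr0.
rewrite -ler_pdivrMl ?normr_gt0//; apply: (le_inf_range 0) => u.
rewrite ler_pdivrMl ?normr_gt0//; apply: (le_trans (attach_le _ (a *: u))).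
by rewrite /attach_cost !linearZ/= -!scalerDr !snormZ !mulrDr.
Qed.

Definition attach : seminorm Z := seminorm_of attachD attachZ.

Lemma ge_attach z u : attach z <= N (z + io u) + q (pi z - u) + c u.
Proof. exact: attach_le. Qed.

(** The hypotheses on [q] and [c] here and in [attach_new] are the two halves of
    [|q u - N (io u)| <= c u]: a detour through the other space is never shorter, so both spaces
    stay isometrically embedded. *)
Lemma attach_old z : (forall u, N (io u) <= q u + c u) -> pi z = 0 ->
  attach z = N z.
Proof.
move=> qc z0; apply/eqP; rewrite eq_le; apply/andP; split.
  apply: (le_trans (ge_attach z 0)).
  by rewrite linear0 addr0 z0 subr0 !snorm0 !addr0.
apply: (le_inf_range 0) => u; rewrite /attach_cost z0 sub0r snormN -addrA.
have := snormD N (z + io u) (- io u); rewrite addrK snormN => /le_trans; apply.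
by rewrite lerD2l.
Qed.

Lemma attach_new z : (forall u, q u <= N (io u) + c u) ->
  (forall u, N (z + io u) = N (io u)) -> attach z = q (pi z).
Proof.
move=> qc zN; apply/eqP; rewrite eq_le; apply/andP; split.
  apply: (le_trans (ge_attach z 0)).
  by rewrite zN linear0 !snorm0 subr0 addr0 add0r.
apply: (le_inf_range 0) => u; rewrite /attach_cost zN addrAC.
have := snormD q u (pi z - u); rewrite addrCA subrr addr0 => /le_trans; apply.
by rewrite lerD2r.
Qed.

End attach.

Lemma eq_attach (R : realType) (V Z : lmodType R) (N : seminorm Z)
    (q c : seminorm V) (io : {linear V -> Z}) (pi : {linear Z -> V}) z z' :
  (forall u, N (z + io u) = N (z' + io u)) -> pi z = pi z' ->
  attach N q c io pi z = attach N q c io pi z'.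
Proof.
move=> zN zpi; rewrite /= /attach_inf.
suff -> : attach_cost N q c io pi z = attach_cost N q c io pi z' by [].
by apply/funext => u; rewrite /attach_cost zN zpi.
Qed.

(** * Weighted sums over the coefficients of a polynomial *)

Section polysum.
Context {R : realType} {A : nzRingType} (f : A -> R) (w : R).
Hypothesis f0 : f 0 = 0.

(** The three instances are [l1norm] ([w = 1]), [wnorm] ([w = 1/2]) and, for polynomials with
    polynomial coefficients, the sum of the [l1norm] of the components. *)
Definition polysum (p : {poly A}) := \sum_(i < size p) w ^+ i * f p`_i.

Lemma polysum_widen n (p : {poly A}) : (size p <= n)%N ->
  polysum p = \sum_(i < n) w ^+ i * f p`_i.
Proof.
move=> pn; rewrite /polysum (big_ord_widen n (fun i => w ^+ i * f p`_i))//.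
rewrite big_mkcond/=; apply: eq_bigr => i _; case: ifPn => //.
by rewrite -leqNgt => /(nth_default 0) ->; rewrite f0 mulr0.
Qed.

Lemma polysum0 : polysum 0 = 0.
Proof. by rewrite /polysum size_poly0 big_ord0. Qed.

Lemma polysumMXaddC p c : polysum (p * 'X + c%:P) = f c + w * polysum p.
Proof.
rewrite (@polysum_widen (size p).+1); last by rewrite size_MXaddC; case: ifP.
rewrite big_ord_recl/= expr0 mul1r -cons_poly_def coef_cons/=; congr (_ + _).
rewrite /polysum mulr_sumr; apply: eq_bigr => i _.
by rewrite coef_cons/= exprS mulrA.
Qed.

Hypotheses (w0 : 0 <= w) (fD : forall a b, f (a + b) <= f a + f b).

Lemma polysumD p q : polysum (p + q) <= polysum p + polysum q.
Proof.
pose n := maxn (size p) (size q).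
rewrite (@polysum_widen n) ?size_polyD// (@polysum_widen n p) ?leq_maxl//.
rewrite (@polysum_widen n q) ?leq_maxr// -big_split/=; apply: ler_sum => i _.
by rewrite coefD -mulrDr ler_wpM2l// exprn_ge0.
Qed.

Lemma polysum_ge0 p : (forall a, 0 <= f a) -> 0 <= polysum p.
Proof. by move=> f_ge0; apply: sumr_ge0 => i _; rewrite mulr_ge0// exprn_ge0. Qed.

End polysum.

(** Stated for any additive [g] because it is applied at two levels: to rationals among reals, then
    to rational polynomials among real ones. *)
Lemma polysum_approx (R : realType) (A A' : nzRingType) (f : A -> R) (w : R)
    (g : {additive A' -> A}) : f 0 = 0 -> (forall a, 0 <= f a) -> 0 <= w ->
  (forall a (e : R), 0 < e -> exists a', f (a - g a') < e) ->
  forall p (e : R), 0 < e -> exists p', polysum f w (p - map_poly g p') < e.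
Proof.
move=> f0 f_ge0 w0 fg; elim/poly_ind => [|p c ih] e e0.
  by exists 0; rewrite raddf0 subr0 polysum0.
have e20 : 0 < e / 2 by rewrite divr_gt0.
have w10 : 0 < w + 1 by rewrite ltr_wpDl.
(* The Horner step multiplies the error on [p] by [w]; dividing by [w + 1] also covers [w = 0]. *)
have [p' pp'] := ih _ (divr_gt0 e20 w10); have [c' cc'] := fg c _ e20.
exists (p' * 'X + c'%:P).
have -> : p * 'X + c%:P - map_poly g (p' * 'X + c'%:P) =
    (p - map_poly g p') * 'X + (c - g c')%:P.
  rewrite raddfD/= map_polyC/= opprD addrACA -polyCN -polyCD mulrBl.
  congr (_ - _ + _); apply/polyP => i.
  by rewrite !(coef_map, coefMX)/=; case: ifP => //; rewrite raddf0.
rewrite polysumMXaddC// (splitr e) ltrD//.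
move: pp'; rewrite ltr_pdivlMr//; apply: le_lt_trans.
by rewrite mulrC ler_wpM2l ?lerDl// polysum_ge0.
Qed.

(** * Direct limit of successive gluings *)

Section amalgam.
Context {R : realType}.

(* The direct sum of countably many copies of [{poly R}], with real scalars: the
   coefficient of degree [k] is the component in the [k]-th copy. *)
Definition polyfam : Type := {poly {poly R}}.
HB.instance Definition _ := GRing.Zmodule.on polyfam.

Definition polyfam_scale (a : R) (z : polyfam) : polyfam := a%:P *: z.

Fact polyfam_scaleA a b z :
  polyfam_scale a (polyfam_scale b z) = polyfam_scale (a * b) z.
Proof. by rewrite /polyfam_scale scalerA -polyCM. Qed.

Fact polyfam_scale1 : left_id 1 polyfam_scale.
Proof. by move=> z; rewrite /polyfam_scale scale1r. Qed.

Fact polyfam_scaleDr : right_distributive polyfam_scale +%R.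
Proof. by move=> a z z'; rewrite /polyfam_scale scalerDr. Qed.

Fact polyfam_scaleDl z : {morph polyfam_scale^~ z : a b / a + b}.
Proof. by move=> a b; rewrite /polyfam_scale polyCD scalerDl. Qed.

HB.instance Definition _ := GRing.Zmodule_isLmodule.Build R polyfam
  polyfam_scaleA polyfam_scale1 polyfam_scaleDr polyfam_scaleDl.

Definition polyfam_in k (v : {poly R}) : polyfam := v *: 'X^k.
Definition polyfam_at k (z : polyfam) : {poly R} := z`_k.

Fact polyfam_in_is_linear k : linear (polyfam_in k).
Proof.
move=> a u v; rewrite /polyfam_in scalerDl; congr (_ + _).
by rewrite -[RHS]/(a%:P *: (u *: 'X^k)) scalerA mul_polyC.
Qed.

Fact polyfam_at_is_linear k : linear (polyfam_at k).
Proof.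
move=> a u v; rewrite /polyfam_at coefD; congr (_ + _).
by rewrite -[a *: u]/(a%:P *: (u : {poly {poly R}})) coefZ mul_polyC.
Qed.

HB.instance Definition _ k := GRing.isLinear.Build R {poly R} polyfam *:%R
  (polyfam_in k) (polyfam_in_is_linear k).
HB.instance Definition _ k := GRing.isLinear.Build R polyfam {poly R} *:%R
  (polyfam_at k) (polyfam_at_is_linear k).

Lemma polyfam_at_in i k v : polyfam_at i (polyfam_in k v) = if i == k then v else 0.
Proof.
rewrite /polyfam_at /polyfam_in coefZ coefXn.
by case: eqP => _; rewrite ?mulr1 ?mulr0.
Qed.

Lemma polyfam_at_default k (z : polyfam) : (size (z : {poly {poly R}}) <= k)%N ->
  polyfam_at k z = 0.
Proof. exact: nth_default. Qed.

Variables (q c : nat -> seminorm {poly R}) (par : nat -> nat).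
Hypothesis par_le : forall k, (par k.+1 <= k)%N.
Hypothesis q_par : forall k v, `|q k.+1 v - q (par k.+1) v| <= c k.+1 v.

Fact amalgam0D (z z' : polyfam) :
  q 0%N (polyfam_at 0 (z + z')) <= q 0%N (polyfam_at 0 z) + q 0%N (polyfam_at 0 z').
Proof. by rewrite linearD snormD. Qed.

Fact amalgam0Z a (z : polyfam) :
  q 0%N (polyfam_at 0 (a *: z)) <= `|a| * q 0%N (polyfam_at 0 z).
Proof. by rewrite linearZ snormZ. Qed.

(** All stages are seminorms on the same space: stage [k] ignores the components above [k], which
    avoids a sequence of varying spaces with transition maps. *)
Fixpoint amalgam_upto k : seminorm polyfam :=
  if k is k'.+1 then
    attach (amalgam_upto k') (q k) (c k) (polyfam_in (par k)) (polyfam_at k)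
  else seminorm_of amalgam0D amalgam0Z.

Lemma eq_amalgam_upto k (z z' : polyfam) :
  (forall i, (i <= k)%N -> polyfam_at i z = polyfam_at i z') ->
  amalgam_upto k z = amalgam_upto k z'.
Proof.
elim: k z z' => [|k ih] z z' zz'; first by rewrite /= zz'.
apply: eq_attach => [u|]; last exact: zz'.
by apply: ih => i ik; rewrite !linearD/= zz'// (leq_trans ik).
Qed.

Lemma q_parD k u : q (par k.+1) u <= q k.+1 u + c k.+1 u.
Proof. by have := q_par k u; rewrite ler_norml => /andP[]; lra. Qed.

Lemma qS_parD k u : q k.+1 u <= q (par k.+1) u + c k.+1 u.
Proof. by have := q_par k u; rewrite ler_norml => /andP[]; lra. Qed.

Lemma amalgam_upto_in k i v : (i <= k)%N ->
  amalgam_upto k (polyfam_in i v) = q i v.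
Proof.
elim: k i v => [|k ih] i v; first by rewrite leqn0 => /eqP ->; rewrite /= polyfam_at_in.
rewrite leq_eqVlt => /predU1P[->|]; last rewrite ltnS => ik.
  rewrite -[in RHS](_ : polyfam_at k.+1 (polyfam_in k.+1 v) = v); last first.
    by rewrite polyfam_at_in eqxx.
  apply: attach_new => u; first by rewrite ih// qS_parD.
  apply: eq_amalgam_upto => j jk.
  by rewrite linearD/= polyfam_at_in ltn_eqF// add0r.
rewrite -ih//; apply: attach_old; first by move=> u; rewrite ih// q_parD.
by rewrite /= polyfam_at_in gtn_eqF.
Qed.

Lemma amalgam_uptoS k z : polyfam_at k.+1 z = 0 ->
  amalgam_upto k.+1 z = amalgam_upto k z.
Proof.
by move=> z0; apply: attach_old => // u; rewrite amalgam_upto_in// q_parD.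
Qed.

(** Attaching a copy does not change the seminorm of a family whose component there is zero, so the
    limit of the stages is already attained at stage [size z]. *)
Definition amalgam_fun (z : polyfam) := amalgam_upto (size (z : {poly {poly R}})) z.

Lemma amalgam_funE k (z : polyfam) : (size (z : {poly {poly R}}) <= k)%N ->
  amalgam_fun z = amalgam_upto k z.
Proof.
rewrite /amalgam_fun; elim: k => [|k ih]; first by rewrite leqn0 => /eqP ->.
rewrite leq_eqVlt => /predU1P[->//|]; rewrite ltnS => zk.
by rewrite ih// amalgam_uptoS// polyfam_at_default// leqW.
Qed.

Fact amalgamD z z' : amalgam_fun (z + z') <= amalgam_fun z + amalgam_fun z'.
Proof.
pose n := maxn (size (z : {poly {poly R}})) (size (z' : {poly {poly R}})).
rewrite (@amalgam_funE n) ?size_polyD// (@amalgam_funE n z) ?leq_maxl//.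
by rewrite (@amalgam_funE n z') ?leq_maxr// snormD.
Qed.

Fact amalgamZ a z : amalgam_fun (a *: z) <= `|a| * amalgam_fun z.
Proof.
by rewrite (@amalgam_funE (size (z : {poly {poly R}}))) ?size_scale_leq// snormZ.
Qed.

Definition amalgam : seminorm polyfam := seminorm_of amalgamD amalgamZ.

Lemma amalgam_in k v : amalgam (polyfam_in k v) = q k v.
Proof.
pose n := maxn k (size (polyfam_in k v : {poly {poly R}})).
by rewrite /= (@amalgam_funE n) ?leq_maxr// amalgam_upto_in// leq_maxl.
Qed.

(** Taking [u = v] in the infimum moves the whole new component onto the parent copy, where it
    cancels. What remains lies in copy [k.+1], which stage [k] ignores, so that only the cost
    [c k.+1 v] is paid. *)
Lemma amalgam_edge k v :
  amalgam (polyfam_in k.+1 v - polyfam_in (par k.+1) v) <= c k.+1 v.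
Proof.
set z := polyfam_in _ _ - _; pose n := maxn k.+1 (size (z : {poly {poly R}})).
have zE m : (k < m)%N -> amalgam_upto m z = amalgam_upto k.+1 z.
  elim: m => // m ih; rewrite ltnS leq_eqVlt => /predU1P[<-//|km].
  rewrite amalgam_uptoS ?ih// linearB/= !polyfam_at_in !gtn_eqF ?subrr//.
  by rewrite ltnS (leq_trans (par_le k))// ltnW.
rewrite /= (@amalgam_funE n) ?leq_maxr// zE ?leq_maxl//.
apply: (le_trans (ge_attach _ _ _ _ _ _ v)).
rewrite [z + _]subrK [X in X + _ + _](_ : _ = 0); last first.
  rewrite -(snorm0 (amalgam_upto k)); apply: eq_amalgam_upto => i ik.
  by rewrite linear0 polyfam_at_in ltn_eqF.
rewrite [GRing.Linear.sort _ z](_ : _ = v); last first.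
  by rewrite linearB/= !polyfam_at_in eqxx gtn_eqF ?subr0// ltnS.
by rewrite subrr snorm0 !add0r.
Qed.

End amalgam.

Definition polyQ (R : realType) : {poly rat} -> {poly R} := map_poly ratr.
HB.instance Definition _ (R : realType) :=
  GRing.RMorphism.copy (@polyQ R) (map_poly ratr).

Definition l1norm (R : realType) (v : {poly R}) : R := polysum Num.norm 1 v.

Section l1norm.
Context {R : realType}.
Implicit Types v : {poly R}.

Lemma l1normD u v : l1norm (u + v) <= l1norm u + l1norm v.
Proof. by apply: polysumD => // *; rewrite ?normr0 ?ler_normD. Qed.

Lemma l1norm_ge0 v : 0 <= l1norm v.
Proof. by apply: polysum_ge0 => // *; exact: ler01. Qed.

Lemma l1normZ a v : l1norm (a *: v) <= `|a| * l1norm v.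
Proof.
rewrite /l1norm (polysum_widen _ _ (size_scale_leq a v)) ?normr0//.
rewrite mulr_sumr; apply: ler_sum => i _.
by rewrite coefZ normrM mulrCA.
Qed.

Lemma polyQ_approx v (e : R) : 0 < e -> exists a, l1norm (v - polyQ R a) < e.
Proof.
move=> e0; apply: polysum_approx => //; first exact: normr0.
move=> a r r0; have [|q] := @rat_in_itvoo R (a - r) (a + r); first by lra.
rewrite in_itv/= => /andP[qa aq]; exists q.
by rewrite ltr_norml; lra.
Qed.

End l1norm.

(** The bound of [q k] by [l1norm] gives separability: the amalgam is at most the sum of the
    [l1norm] of the components, for which families with rational coefficients are dense. *)
Lemma universal_family (R : realType) (B : sepBanachType R)
    (q c : nat -> seminorm {poly R}) (par : nat -> nat) :
  universal B ->
  (forall k, (par k.+1 <= k)%N) ->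
  (forall k v, `|q k.+1 v - q (par k.+1) v| <= c k.+1 v) ->
  (forall k v, q k v <= l1norm v) ->
  exists j : nat -> {linear {poly R} -> B}, (forall k v, `|j k v| = q k v) /\
    forall k v, `|j k.+1 v - j (par k.+1) v| <= c k.+1 v.
Proof.
move=> uB par_le q_par q_le; pose N := amalgam par_le q_par.
have N_le z : N z <= polysum (@l1norm R) 1 z.
  rewrite -{1}[z]coefK poly_def; apply: (le_trans (snorm_sum _ _ _)).
  apply: ler_sum => i _; rewrite expr1n mul1r.
  by rewrite [N _](amalgam_in par_le q_par).
have l10 : l1norm (0 : {poly R}) = 0 by rewrite /l1norm polysum0.
have [f fN] : exists f : {linear @polyfam R -> B}, forall z, `|f z| = N z.
  apply: (@universal_seminorm _ _ _ _ (range (map_poly (@polyQ R) : _ -> @polyfam R))) => //.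
    by apply: sub_countable (card_image_le _ _) _; exact: countableP.
  move=> z e e0.
  have [z' zz'] := @polysum_approx _ _ _ (@l1norm R) 1 (@polyQ R) l10 l1norm_ge0
    ler01 polyQ_approx z e e0.
  by exists (map_poly (@polyQ R) z'); [exists z'|exact: le_lt_trans (N_le _) zz'].
exists (fun k => f \o polyfam_in k); split=> k v /=.
  by rewrite fN [LHS]amalgam_in.
by rewrite -linearB fN; exact: amalgam_edge.
Qed.

(** * Measurable families of seminorms *)

(** The bound on the seminorms [p_x] that [|w_n| <= 2^-n] provides. The unit ball of [l1norm] is
    totally bounded for this norm, which it is not for [l1norm] itself. *)
Definition wnorm (R : realType) (v : {poly R}) : R := polysum Num.norm 2^-1 v.

Section wnorm.
Context {R : realType}.
Implicit Types v : {poly R}.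

Lemma wnormD u v : wnorm (u + v) <= wnorm u + wnorm v.
Proof. by apply: polysumD => // *; rewrite ?normr0 ?ler_normD. Qed.

Lemma wnorm_le_l1 v : wnorm v <= l1norm v.
Proof.
apply: ler_sum => i _; rewrite ler_wpM2r//.
by rewrite expr1n exprn_ile1// invf_le1// ler1n.
Qed.

Lemma wnormN v : wnorm (- v) = wnorm v.
Proof.
rewrite /wnorm /polysum size_polyN; apply: eq_bigr => i _.
by rewrite coefN normrN.
Qed.

Lemma rat_net_itv (e : R) : 0 < e ->
  exists s : seq rat, forall c : R, `|c| <= 1 -> exists2 q, q \in s & `|c - ratr q| <= e.
Proof.
move=> e0; have [m] := ltr_add_invr e0; rewrite add0r => me.
(* A grid of mesh [1 / m.+1] from -1 to 1 with both ends included: [c = 1] falls on the last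
   index. *)
exists [seq i%:R / m.+1%:R - 1 | i <- iota 0 m.+1.*2.+1] => c.
rewrite ler_norml => /andP[c0 c1]; have m0 : 0 < m.+1%:R :> R by [].
have cm0 : 0 <= (c + 1) * m.+1%:R by rewrite mulr_ge0//; lra.
have /andP[lec ltc] := truncn_itv cm0; set n := Num.truncn _ in lec ltc.
exists (n%:R / m.+1%:R - 1).
  apply/mapP; exists n => //; rewrite mem_iota/= add0n ltnS -(ler_nat R) -mul2n natrM.
  by rewrite (le_trans lec)// ler_wpM2r//; lra.
rewrite rmorphB rmorph1 rmorphM fmorphV/= !ratr_nat.
move: lec ltc; rewrite -ler_pdivrMr// -ltr_pdivlMr// -[n.+1%:R]natr1 mulrDl mul1r => lec ltc.
move: lec ltc me; move: (n%:R : R) (m.+1%:R^-1 : R) => a b.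
by rewrite ler_norml; lra.
Qed.

(* In the weighted norm the tail of a polynomial is halved at each degree, so
   that a net for the constant coefficient gives nets for polynomials. *)
Lemma l1norm_wnet n : exists s : seq {poly rat}, forall v : {poly R},
  l1norm v <= 1 -> exists2 a, a \in s & wnorm (v - polyQ R a) <= (3 / 4) ^+ n.
Proof.
elim: n => [|n [s sP]].
  exists [:: 0] => v v1; exists 0; rewrite ?mem_head// raddf0 subr0 expr0.
  exact: le_trans (wnorm_le_l1 v) v1.
(* The error on the tail is halved and the constant coefficient adds a quarter, whence the ratio
   [1/2 + 1/4 = 3/4]. *)
have e0 : 0 < (3 / 4) ^+ n / 4 :> R by rewrite divr_gt0// exprn_gt0// divr_gt0.
have [t tP] := rat_net_itv e0.
exists [seq a * 'X + q%:P | a <- s, q <- t] => w.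
have [v [c ->{w}]] : exists v c, w = v * 'X + c%:P.
  elim/poly_ind: w => [|v c _]; last by exists v, c.
  by exists 0, 0; rewrite mul0r addr0.
rewrite /l1norm polysumMXaddC ?normr0// mul1r -/(l1norm v) => vc.
have c1 : `|c| <= 1 by rewrite (le_trans _ vc)// lerDl l1norm_ge0.
have [a sa va] : exists2 a, a \in s & wnorm (v - polyQ R a) <= (3 / 4) ^+ n.
  by apply: sP; rewrite (le_trans _ vc)// lerDr.
have [q tq cq] := tP _ c1.
exists (a * 'X + q%:P); first by apply/allpairsP; exists (a, q).
have -> : v * 'X + c%:P - polyQ R (a * 'X + q%:P) =
    (v - polyQ R a) * 'X + (c - ratr q)%:P.
  rewrite rmorphD rmorphM/= [polyQ R q%:P]map_polyC [polyQ R 'X]map_polyX/=.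
  by rewrite opprD addrACA mulrBl polyCB.
rewrite /wnorm polysumMXaddC ?normr0// exprS -/(wnorm _).
move: va cq; set y := (3 / 4) ^+ n; lra.
Qed.

End wnorm.

(* The pointwise norm of the module is only meaningful on countably many elements
   at once, hence the seminorms are first given on rational polynomials. *)
Section extension.
Context {R : realType}.
Variable p : {poly rat} -> R.
Hypothesis pD : forall a b, p (a + b) <= p a + p b.
Hypothesis pZ : forall c a, p (c *: a) = `|ratr c| * p a.
Hypothesis p_le : forall a, p a <= wnorm (polyQ R a).

Fact rat_seminorm_ge0 a : 0 <= p a.
Proof.
have pN : p (- a) = p a by rewrite -scaleN1r pZ rmorphN rmorph1 normrN1 mul1r.
have p0 : p 0 = 0 by rewrite -(scale0r 0) pZ rmorph0 normr0 mul0r.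
by have := pD a (- a); rewrite subrr p0 pN; lra.
Qed.

(** McShane's formula: on rational polynomials [p] is 1-Lipschitz for [l1norm], and this infimum
    extends it with the same constant. *)
Definition extension_fun (v : {poly R}) : R :=
  inf (range (fun a => p a + l1norm (v - polyQ R a))).

Fact le_extension_fun v a : extension_fun v <= p a + l1norm (v - polyQ R a).
Proof.
by apply: ge_inf_range => b; rewrite addr_ge0 ?l1norm_ge0 ?rat_seminorm_ge0.
Qed.

Fact extension_fun_ge0 v : 0 <= extension_fun v.
Proof.
by apply: (le_inf_range 0) => b; rewrite addr_ge0 ?l1norm_ge0 ?rat_seminorm_ge0.
Qed.

Fact extensionD u v : extension_fun (u + v) <= extension_fun u + extension_fun v.
Proof.
apply: (le_infD_range 0) => a b; apply: (le_trans (le_extension_fun _ (a + b))).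
have := pD a b; have := l1normD (u - polyQ R a) (v - polyQ R b).
by rewrite addrACA -opprD -raddfD; lra.
Qed.

Fact extension_fun_lip u v : extension_fun u <= extension_fun v + l1norm (u - v).
Proof.
rewrite -lerBlDr; apply: (le_inf_range 0) => a.
have := le_extension_fun u a; have := l1normD (u - v) (v - polyQ R a).
by rewrite addrA subrK; lra.
Qed.

Fact extension_fun_ratZ c v :
  extension_fun (ratr c *: v) <= `|ratr c| * extension_fun v.
Proof.
have [->|c0] := eqVneq c 0.
  rewrite rmorph0 normr0 mul0r scale0r (le_trans (le_extension_fun _ 0))//.
  rewrite raddf0 subr0 /l1norm polysum0 addr0.
  by rewrite -(scale0r 0) pZ rmorph0 normr0 mul0r.
have rc0 : 0 < `|ratr c : R| by rewrite normr_gt0 fmorph_eq0.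
rewrite -ler_pdivrMl//; apply: (le_inf_range 0) => a.
rewrite ler_pdivrMl//; apply: (le_trans (le_extension_fun _ (c *: a))).
rewrite pZ mulrDr lerD2l; apply: le_trans (l1normZ _ _).
by rewrite scalerBr {1}/polyQ linearZ.
Qed.

Fact extensionZ a v : extension_fun (a *: v) <= `|a| * extension_fun v.
Proof.
apply/ler_addgt0Pr => e e0.
(* Replacing [a] by a rational [c] costs [|a - c| * l1norm v] by the Lipschitz bound and at most
   [|a - c| * extension_fun v] through [|c|]. With [|a - c| <= e / k] the total is at most [e]. *)
pose k := extension_fun v + l1norm v + 1.
have k0 : 0 < k.
  by have := extension_fun_ge0 v; have := l1norm_ge0 v; rewrite /k; lra.
have ek : 0 < e / k by rewrite divr_gt0.
have [|c] := @rat_in_itvoo R (a - e / k) (a + e / k); first by lra.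
rewrite in_itv/= => /andP[ac ca].
have acek : `|a - ratr c| <= e / k by rewrite ler_norml; lra.
apply: (le_trans (extension_fun_lip _ (ratr c *: v))).
rewrite -scalerBl; have := l1normZ (a - ratr c) v.
have := extension_fun_ratZ c v.
have : `|ratr c| * extension_fun v <= (`|a| + e / k) * extension_fun v.
  rewrite ler_wpM2r ?extension_fun_ge0//.
  by have := ler_normD a (ratr c - a); rewrite addrC subrK distrC; lra.
have : `|a - ratr c| * l1norm v <= e / k * l1norm v by rewrite ler_wpM2r ?l1norm_ge0.
have : e / k * k = e by rewrite divfK// gt_eqF.
by rewrite {2}/k => *; nra.
Qed.

Definition extension : seminorm {poly R} := seminorm_of extensionD extensionZ.

Lemma extension_polyQ a : extension (polyQ R a) = p a.
Proof.
apply/eqP; rewrite eq_le; apply/andP; split.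
  apply: (le_trans (le_extension_fun _ a)).
  by rewrite subrr /l1norm polysum0 addr0.
apply: (le_inf_range 0) => b; rewrite -raddfB.
have := pD b (a - b); rewrite [b + _]addrC subrK => /le_trans; apply.
by rewrite lerD2l (le_trans (p_le _))// wnorm_le_l1.
Qed.

Lemma extension_le_wnorm v : extension v <= wnorm v.
Proof.
apply/ler_addgt0Pr => e e0.
have [|a va] := @polyQ_approx _ v (e / 2); first by rewrite divr_gt0.
apply: (le_trans (le_extension_fun _ a)).
have := p_le a; have := wnormD v (polyQ R a - v); rewrite [v + _]addrC subrK -opprB wnormN.
by have := wnorm_le_l1 (v - polyQ R a); lra.
Qed.

End extension.

(** For countable [T] this is measurability for the discrete sigma-algebra; working with level sets
    spares a measurable structure on each type of codes. *)
Definition measurable_levels {d} {X : measurableType d} {T : Type} (f : X -> T) :=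
  forall t, measurable (f @^-1` [set t]).

Section measurable_levels.
Context {d : measure_display} {X : measurableType d}.

Lemma measurable_levels_cst (T : Type) (t : T) : measurable_levels (fun _ : X => t).
Proof.
move=> s; have [<-|ts] := pselect (t = s).
  rewrite (_ : _ @^-1` _ = setT); first exact: measurableT.
  by apply/seteqP; split.
rewrite (_ : _ @^-1` _ = set0); first exact: measurable0.
by apply/seteqP; split.
Qed.

Lemma measurable_levels_inj (T S : Type) (f : X -> T) (g : T -> S) :
  injective g -> measurable_levels f -> measurable_levels (g \o f).
Proof.
move=> gI mf s; have [[t <-]|nt] := pselect (exists t, g t = s).
  rewrite (_ : _ @^-1` _ = f @^-1` [set t]); first exact: mf.
  by apply/seteqP; split => x /= => [/gI|->].
rewrite (_ : _ @^-1` _ = set0); first exact: measurable0.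
by apply/seteqP; split => x //= gfx; apply: nt; exists (f x).
Qed.

Lemma measurable_levels_cons (T : Type) (f : X -> T) (g : X -> seq T) :
  measurable_levels f -> measurable_levels g ->
  measurable_levels (fun x => f x :: g x).
Proof.
move=> mf mg [|t s].
  rewrite (_ : _ @^-1` _ = set0); first exact: measurable0.
  by apply/seteqP; split.
rewrite (_ : _ @^-1` _ = f @^-1` [set t] `&` g @^-1` [set s]).
  by apply: measurableI; [exact: mf|exact: mg].
by apply/seteqP; split => x /= => [[-> ->]|[-> ->]].
Qed.

Lemma measurable_levels_floor (R : realType) (f : X -> R) :
  measurable_fun setT f -> measurable_levels (fun x => Num.floor (f x)).
Proof.
move=> mf z; rewrite (_ : _ @^-1` _ = f @^-1` `[z%:~R, (z + 1)%:~R[%classic).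
  by rewrite -[X in measurable X]setTI; apply: mf => //; exact: measurable_itv.
apply/seteqP; split => x /=; rewrite in_itv/=; last exact: floor_def.
by move=> <-; exact: floor_itv.
Qed.

Lemma measurable_levels_seq (A T : Type) (s : seq A) (f : A -> X -> T) :
  (forall a, measurable_levels (f a)) ->
  measurable_levels (fun x => [seq f a x | a <- s]).
Proof.
move=> mf; elim: s => [|a s ih] /=; first exact: measurable_levels_cst.
exact: measurable_levels_cons.
Qed.

Lemma measurable_levels_bigcup (T : countType) (f : X -> T) (A : T -> set X) :
  measurable_levels f -> (forall t, measurable (A t)) ->
  measurable [set x | A (f x) x].
Proof.
move=> mf mA; rewrite (_ : [set x | _] = \bigcup_t (f @^-1` [set t] `&` A t)).
  by apply: countable_bigcupT_measurable => // t; apply: measurableI; [exact: mf|].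
by apply/seteqP; split=> x /= => [fx|[t _ [<-]]//]; exists (f x).
Qed.

End measurable_levels.

(** The code of [c :: s] is [2 ^ c * (2 * CodeSeq.code s + 1)]. Copies attached in the order of
    codes thus always find their parent in place. *)
Lemma ltn_code_cons c s : (CodeSeq.code s < CodeSeq.code (c :: s))%N.
Proof.
rewrite /= (@leq_trans (CodeSeq.code s).*2.+1)// ?ltnS -?addnn ?leq_addr//.
by rewrite leq_pmull// expn_gt0.
Qed.

(** * Partition into cells on which the seminorm is almost constant *)

Section cells.
Context {d : measure_display} {X : measurableType d} {R : realType}.
Variable P : {poly rat} -> X -> R.
Hypothesis mP : forall a, measurable_fun setT (P a).
Hypothesis PD : forall a b x, P (a + b) x <= P a x + P b x.
Hypothesis PZ : forall c a x, P (c *: a) x = `|ratr c| * P a x.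
Hypothesis P_le : forall a x, P a x <= wnorm (polyQ R a).

Let p x : seminorm {poly R} :=
  extension (fun a b => PD a b x) (fun c a => PZ c a x).

Let p_polyQ x a : p x (polyQ R a) = P a x.
Proof. by apply: extension_polyQ => b; exact: P_le. Qed.

Let p_wnorm x v : p x v <= wnorm v.
Proof. by apply: extension_le_wnorm => b; exact: P_le. Qed.

Let p_l1norm x v : p x v <= l1norm v.
Proof. exact: le_trans (p_wnorm x v) (wnorm_le_l1 v). Qed.

(** The code rounds, at mesh [e / 3], the values of [p_x] on a finite net of the unit ball of
    [l1norm]. The error [e] is made of three thirds: from [v] to the net at [x], the rounding, and
    back to [v] at [y]. Other [v] follow by homogeneity. *)
Lemma cell_code (e : R) : 0 < e -> exists code : X -> nat, measurable_levels code /\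
  forall x y, code x = code y -> forall v, `|p x v - p y v| <= e * l1norm v.
Proof.
move=> e0; have e30 : 0 < e / 3 by rewrite divr_gt0.
have [n ne] : exists n, ((3 / 4) ^+ n : R) <= e / 3.
  have : (3 / 4 : R) ^+ n @[n --> \oo] --> (0 : R).
    by apply: cvg_expr; rewrite ger0_norm; lra.
  move/cvgrPdist_le => /(_ _ e30)[n _ /(_ n (leqnn n))].
  by rewrite sub0r normrN ger0_norm ?exprn_ge0//; exists n.
have [s sP] := @l1norm_wnet R n.
pose K := (e / 3)^-1; have K0 : 0 < K by rewrite invr_gt0.
exists (fun x => pickle [seq Num.floor (K * P a x) | a <- s]); split.
  apply: (@measurable_levels_inj _ _ _ _ _ pickle); first exact: pcan_inj pickleK.
  apply: measurable_levels_seq => a; apply: measurable_levels_floor.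
  exact: measurable_funM.
move=> x y /(pcan_inj pickleK)/eq_in_map xy.
have unit v : l1norm v <= 1 -> `|p x v - p y v| <= e.
  move=> /sP[a sa va].
  have h z : `|p z v - P a z| <= e / 3.
    rewrite -p_polyQ (le_trans (snorm_dist _ _ _))// (le_trans (p_wnorm _ _))//.
    exact: le_trans va ne.
  have : `|P a x - P a y| <= e / 3.
    have /andP[] := floor_itv (K * P a x); have /andP[] := floor_itv (K * P a y).
    rewrite xy// !intrD => y1 y2 x1 x2.
    have : `|K * P a x - K * P a y| <= 1 by rewrite ler_norml; lra.
    by rewrite -mulrBr normrM gtr0_norm// -ler_pdivlMl// mulr1 invrK.
  have := h x; have := h y; rewrite !ler_norml => /andP[? ?] /andP[? ?] /andP[? ?].
  by apply/andP; split; lra.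
move=> v; have [v0|v0] := eqVneq (l1norm v) 0.
  rewrite v0 mulr0; have := p_l1norm x v; have := p_l1norm y v.
  have := snorm_ge0 (p x) v; have := snorm_ge0 (p y) v.
  by rewrite v0 ler_norml; lra.
have v1 : 0 < l1norm v by rewrite lt_neqAle eq_sym v0 l1norm_ge0.
have aE : `|(l1norm v)^-1| = (l1norm v)^-1 by rewrite ger0_norm// invr_ge0 ltW.
have := unit ((l1norm v)^-1 *: v); rewrite !snormZ aE -mulrBr normrM aE.
rewrite ler_pdivrMl// mulrC; apply.
by rewrite (le_trans (l1normZ _ _))// aE mulVf.
Qed.

End cells.

Lemma cvg_half_steps (R : realType) (V : completeNormedModType R) (u : nat -> V)
    (C : R) : (forall k, `|u k.+1 - u k| <= C * 2^-1 ^+ k) -> cvgn u.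
Proof.
move=> uC; rewrite (_ : u = (fun n => u 0%N + series (telescope u) n)); last first.
  by apply/funext => n; exact: eq_sum_telescope.
apply: is_cvgD; first exact: is_cvg_cst.
have C0 : 0 <= C by have := uC 0%N; rewrite expr0 mulr1; apply: le_trans.
apply: normed_cvg; apply: (@series_le_cvg _ _ (geometric C 2^-1)) => //=.
  by move=> n; rewrite /geometric/= mulr_ge0// exprn_ge0 ?invr_ge0.
by apply: is_cvg_geometric_series; rewrite ger0_norm// invf_lt1// ltr1n.
Qed.

(* The cells of level [k] are the fibers of [history code k]; the cell of a
   sequence [s] has number [CodeSeq.code s], so that the parent cell [behead s] has
   a smaller number. *)
Fixpoint history (X : Type) (code : nat -> X -> nat) k x : seq nat :=
  if k is k'.+1 then code k' x :: history code k' x else [::].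

Lemma size_history X (code : nat -> X -> nat) k x : size (history code k x) = k.
Proof. by elim: k => //= k ->. Qed.

Lemma measurable_levels_history d (X : measurableType d) (code : nat -> X -> nat) k :
  (forall n, measurable_levels (code n)) -> measurable_levels (history code k).
Proof.
move=> mc; elim: k => [|k ih]; first exact: measurable_levels_cst.
exact: measurable_levels_cons.
Qed.

(* The absolute value makes this a seminorm for all [e]. *)
Definition scaled_l1 (R : realType) (e : R) : seminorm {poly R}.
Proof.
apply: (@seminorm_of _ _ (fun v => `|e| * l1norm v)) => [u v|a v].
  by rewrite -mulrDr ler_wpM2l// l1normD.
by rewrite mulrCA ler_wpM2l// l1normZ.
Defined.

Definition null_seminorm (R : realType) (V : lmodType R) : seminorm V.
Proof. by apply: (@Seminorm _ _ (fun=> 0)) => [u v|a v]; rewrite ?addr0 ?mulr0. Defined.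

(** * Limit of the embeddings along the branches of the tree *)

Section cells_embedding.
Context {d : measure_display} {X : measurableType d} {R : realType}.
Variable p : X -> seminorm {poly R}.
Variable B : sepBanachType R.
Hypothesis uB : universal B.
Hypothesis p_l1norm : forall x v, p x v <= l1norm v.
Hypothesis cells : forall e : R, 0 < e ->
  exists code : X -> nat, measurable_levels code /\
    forall x y, code x = code y -> forall v, `|p x v - p y v| <= e * l1norm v.

Lemma measurable_embedding_of_cells :
  exists J : X -> {linear {poly R} -> B},
    (forall v, measurable_fun setT ((fun x => J x v) : X -> borel B)) /\
    forall x v, `|J x v| = p x v.
Proof.
have half0 k : 0 < 2^-1 ^+ k :> R by rewrite exprn_gt0// invr_gt0.
(* The shift matches levels: a history of length [k.+1] begins with [code k] and so fixes the
   seminorm up to [2^-(k+1)]. For the empty history the bound by [l1norm] suffices. *)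
have /choice[code /all_and2[mcode codeP]] k := cells (half0 k.+1).
have p_dist1 x y v : `|p x v - p y v| <= l1norm v.
  have := snorm_ge0 (p x) v; have := snorm_ge0 (p y) v.
  by have := p_l1norm x v; have := p_l1norm y v; rewrite ler_norml; lra.
have hist_close k x y v : history code k x = history code k y ->
    `|p x v - p y v| <= 2^-1 ^+ k * l1norm v.
  by case: k => [_|k [/codeP + _]]; [rewrite expr0 mul1r|exact].
pose cell m := [set x | history code (size (CodeSeq.decode m)) x = CodeSeq.decode m].
have /choice[y yP] m : exists o : option X, if o is Some z then cell m z else cell m = set0.
  have [->|/set0P[z mz]] := eqVneq (cell m) set0; first by exists None.
  by exists (Some z).
(* An empty cell receives the zero seminorm, and below the edge cost [l1norm], which dominates every
   [q]; the branch of a point never meets such a cell. *)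
pose q m : seminorm {poly R} := if y m is Some z then p z else @null_seminorm R _.
(* The points chosen in a cell of level [k.+1] and in its parent share only a history of length [k],
   whence the predecessor in the exponent. *)
pose c m : seminorm {poly R} := scaled_l1
  (if y m is Some _ then 2^-1 ^+ (size (CodeSeq.decode m)).-1 else 1 : R).
pose par m := CodeSeq.code (behead (CodeSeq.decode m)).
have decodeS k : exists a s, CodeSeq.decode k.+1 = a :: s.
  case E : (CodeSeq.decode k.+1) => [|a s]; last by exists a, s.
  by have := CodeSeq.decodeK k.+1; rewrite E.
have par_le k : (par k.+1 <= k)%N.
  have [a [s E]] := decodeS k; rewrite /par E/= -ltnS -(CodeSeq.decodeK k.+1) E.
  exact: ltn_code_cons.
have q_l1 m v : q m v <= l1norm v.
  by rewrite /q; case: (y m) => [z|]; [exact: p_l1norm|exact: l1norm_ge0].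
have q_par k v : `|q k.+1 v - q (par k.+1) v| <= c k.+1 v.
  have [a [s E]] := decodeS k; have := yP k.+1; have := yP (par k.+1).
  rewrite /c /q /par /cell E/= CodeSeq.codeK/=.
  case: (y k.+1) => [z|]; last first.
    move=> _ _; rewrite sub0r normrN normr1 mul1r.
    by rewrite -[X in `|X|]/(q (CodeSeq.code s) v) ger0_norm ?snorm_ge0.
  case: (y (CodeSeq.code s)) => [z'|].
    move=> sz' [_ sz]; rewrite (ger0_norm (ltW (half0 _))).
    by apply: hist_close; rewrite sz sz'.
  (* The point chosen in a cell also lies in the parent cell, which therefore is not empty. *)
  by move=> /seteqP[/(_ z) s0 _] [_ /s0].
have [j [jq j_par]] := universal_family uB par_le q_par q_l1.
pose node k x := CodeSeq.code (history code k x).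
pose Jk k x := j (node k x).
have nodeP k x : exists2 z, y (node k x) = Some z &
    history code k z = history code k x.
  have := yP (node k x); rewrite /cell /node CodeSeq.codeK size_history.
  case: (y _) => [z|]; first by exists z.
  by move=> /seteqP[/(_ x)] /(_ erefl).
have Jk_step x v k : `|Jk k.+1 x v - Jk k x v| <= l1norm v * 2^-1 ^+ k.
  have [z yz _] := nodeP k.+1 x.
  (* The edge estimate concerns successors; the root, with code 0, is the only cell without a
     parent. *)
  have [n nE] : exists n, node k.+1 x = n.+1.
    have := ltn_code_cons (code k x) (history code k x).
    by rewrite /node/=; case: (2 ^ _ * _)%N => // n; exists n.
  have pE : par (node k.+1 x) = node k x by rewrite /par /node CodeSeq.codeK.
  have cE : c (node k.+1 x) v = l1norm v * 2^-1 ^+ k.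
    rewrite /c yz /node CodeSeq.codeK size_history/= mulrC.
    by rewrite (ger0_norm (ltW (half0 _))).
  by rewrite /Jk -pE -cE nE.
have Jk_norm x v k : `| `|Jk k x v| - p x v| <= 2^-1 ^+ k * l1norm v.
  have [z yz zx] := nodeP k x.
  by rewrite jq /q yz hist_close.
have Jk_cvg x v : cvgn (fun k => Jk k x v) by exact: cvg_half_steps (Jk_step x v).
have /choice[J JE] x : exists f : {linear {poly R} -> B},
    forall v, Jk k x v @[k --> \oo] --> f v.
  have fl : linear (fun v => limn (fun k => Jk k x v)).
    move=> a u v; apply/cvg_lim => //; under eq_fun do rewrite linearP.
    by apply: cvgD; [apply: cvgZl_tmp|]; exact: Jk_cvg.
  pose fL := GRing.isLinear.Build R {poly R} B *:%R _ fl.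
  pose f : {linear {poly R} -> B} := HB.pack (fun v => limn (fun k => Jk k x v)) fL.
  by exists f => v; exact: Jk_cvg.
exists J; split=> [v|x v].
  apply: measurable_borel; apply: (@measurable_borel_lim _ _ R B (fun k x => Jk k x v)).
    move=> k U oU.
    (* At a fixed level the map depends on [x] only through its cell, so the preimage of [U] is a
       countable union of cells. *)
    apply: (@measurable_levels_bigcup _ X nat (node k) (fun m => [set _ | U (j m v)])) => [|m].
      apply: measurable_levels_inj (can_inj CodeSeq.codeK) _.
      exact: measurable_levels_history.
    have [Um|Um] := pselect (U (j m v)).
      rewrite (_ : mkset _ = setT); first exact: measurableT.
      by apply/seteqP; split.
    rewrite (_ : mkset _ = set0); first exact: measurable0.
    by apply/seteqP; split.
  by move=> x; exact: JE.
apply: (@cvg_unique _ _ (`|Jk k x v| @[k --> \oo])) => //.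
  by apply: cvg_norm; exact: JE.
apply/cvgrPdist_le => e e0.
have : 2^-1 ^+ k * l1norm v @[k --> \oo] --> (0 : R).
  rewrite -(mul0r (l1norm v)); apply: cvgMr_tmp; apply: cvg_expr.
  by rewrite ger0_norm// invf_lt1// ltr1n.
move/cvgrPdist_le => /(_ _ e0); apply: filterS => k.
rewrite sub0r normrN distrC => /(le_trans _); apply.
by rewrite (le_trans (Jk_norm x v k))// ler_norm.
Qed.

End cells_embedding.

Lemma measurable_embedding (d : measure_display) (X : measurableType d)
    (R : realType) (P : {poly rat} -> X -> R) (B : sepBanachType R) :
  universal B ->
  (forall a, measurable_fun setT (P a)) ->
  (forall a b x, P (a + b) x <= P a x + P b x) ->
  (forall c a x, P (c *: a) x = `|ratr c| * P a x) ->
  (forall a x, P a x <= wnorm (polyQ R a)) ->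
  exists J : X -> {linear {poly R} -> B},
    (forall v, measurable_fun setT ((fun x => J x v) : X -> borel B)) /\
    (forall x v, `|J x v| <= l1norm v) /\
    forall x a, `|J x (polyQ R a)| = P a x.
Proof.
move=> uB mP PD PZ P_le.
have [|J [mJ Jp]] := measurable_embedding_of_cells uB _ (cell_code mP PD PZ P_le).
  move=> x v; apply: le_trans (wnorm_le_l1 v).
  by apply: extension_le_wnorm => a; exact: P_le.
exists J; split=> //; split=> x v; rewrite Jp.
  apply: le_trans (wnorm_le_l1 v).
  by apply: extension_le_wnorm => a; exact: P_le.
by apply: extension_polyQ => a; exact: P_le.
Qed.

(** * Isometric graphs between normed modules *)

Section L0_module.
Context {d : measure_display} {X : measurableType d} {R : realType}.
Context {mu : {measure set X -> \bar R}} {m' : equivProbability mu}.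
Implicit Types V : normedL0ModType m'.

Lemma pnorm0 V : pnorm (0 : V) = 0 :> L0 mu.
Proof. exact/pnorm_eq0. Qed.

Lemma pnormN V (v : V) : pnorm (- v) = pnorm v :> L0 mu.
Proof.
apply: L0P; near=> x; rewrite -scaleN1r (near (pnormZ (-1) v) x)//.
by rewrite (near (L0N (1 : L0 mu)) x)// (near (L01 mu) x)// normrN1 mul1r.
Unshelve. all: by end_near. Qed.

Lemma pnormBC V (v w : V) : pnorm (v - w) = pnorm (w - v) :> L0 mu.
Proof. by rewrite -opprB pnormN. Qed.

Lemma pnorm_dist V (v w : V) :
  \forall x \ae mu, `|pnorm v x - pnorm w x| <= pnorm (v - w) x.
Proof.
near=> x; rewrite ler_norml lerBlDr; apply/andP; split; last first.
  by rewrite -[in leLHS](subrK w v); near: x; exact: ler_pnormD.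
rewrite lerNl opprB lerBlDr -[in leLHS](subrK v w) pnormBC.
by near: x; exact: ler_pnormD.
Unshelve. all: by end_near. Qed.

Let h (f : L0 mu) x : R := Num.min `|f x - (0 : L0 mu) x| 1.

Let h_ge0 f x : 0 <= h f x.
Proof. by rewrite le_min normr_ge0 ler01. Qed.

Let h_le1 f x : h f x <= 1.
Proof. by rewrite ge_min lexx orbT. Qed.

Let mh f : measurable_fun setT (fun x => (h f x)%:E).
Proof.
apply/measurable_EFinP; apply: measurable_minr; last exact: measurable_cst.
apply: measurableT_comp => //.
by apply: measurable_funB; exact: measurable_L0.
Qed.

Let h_fin f : (\int[m']_x (h f x)%:E)%E \is a fin_num.
Proof.
rewrite ge0_fin_numE ?integral_ge0//; last by move=> x _; rewrite lee_fin.
rewrite (@le_lt_trans _ _ (\int[m']_x (cst 1%E) x)%E)//.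
  by apply: ge0_le_integral => //[x _|x _]; rewrite lee_fin.
by rewrite integral_cst// mul1e (le_lt_trans (eprob_le1 m'))// ltry.
Qed.

Lemma L0dist_ge0 (f : L0 mu) : 0 <= L0dist m' f 0.
Proof. by apply: fine_ge0; apply: integral_ge0 => x _; rewrite lee_fin. Qed.

Lemma mdistL0C V (v w : V) : mdistL0 v w = mdistL0 w v.
Proof. by rewrite /mdistL0 pnormBC. Qed.

Lemma mdistL0_trans V (u v w : V) : mdistL0 v w <= mdistL0 v u + mdistL0 u w.
Proof.
have E (a b : V) : mdistL0 a b = fine (\int[m']_x (h (pnorm (a - b)) x)%:E)%E by [].
rewrite !E -fineD ?h_fin//; apply: fine_le; [exact: h_fin| |].
  by apply: (etrans (fin_numD _ _)); rewrite !h_fin.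
rewrite -ge0_integralD//=; try by move=> x _; rewrite lee_fin.
apply: ae_ge0_le_integral => //=.
- by move=> x _; rewrite lee_fin.
- by move=> x _; rewrite -EFinD lee_fin addr_ge0.
- exact: emeasurable_funD.
have : \forall x \ae mu, h (pnorm (v - w)) x <= h (pnorm (v - u)) x + h (pnorm (u - w)) x.
  near=> x; rewrite /h (near (L00 mu) x)// !subr0.
  rewrite !ger0_norm; [|by near: x; exact: pnorm_ge0..].
  have : pnorm (v - w) x <= pnorm (v - u) x + pnorm (u - w) x.
    by rewrite -[in leLHS](subrKA u); near: x; exact: ler_pnormD.
  have : 0 <= pnorm (v - u) x by near: x; exact: pnorm_ge0.
  have : 0 <= pnorm (u - w) x by near: x; exact: pnorm_ge0.
  move: (pnorm (v - w) x) (pnorm (v - u) x) (pnorm (u - w) x) => a b c.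
  by case: (ltP a 1); case: (ltP b 1); case: (ltP c 1); lra.
by move=> /(ae_eprob m'); apply: filterS => x + _; rewrite -EFinD lee_fin.
Unshelve. all: by end_near. Qed.

Definition ae_cvg V (u : nat -> V) (v : V) :=
  \forall x \ae mu, pnorm (u n - v) x @[n --> \oo] --> (0 : R).

(** Markov's inequality and the Borel-Cantelli lemma: one factor [2^-n] is spent on the threshold
    [r n], the other bounds the measure of [F n] and is summable. *)
Lemma ae_cvg_fast V (u : nat -> V) v :
  (forall n, mdistL0 (u n) v < 2^-1 ^+ n * 2^-1 ^+ n) -> ae_cvg u v.
Proof.
move=> uv; pose r k : R := 2^-1 ^+ k.
have r0 k : 0 < r k by rewrite exprn_gt0// invr_gt0.
pose f k := pnorm (u k - v).
pose F k := [set x | r k <= h (f k) x].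
have mF k : measurable (F k).
  have /measurable_EFinP mhk := mh (f k).
  have := mhk measurableT _ (measurable_itv `[r k, +oo[%R).
  rewrite setTI; congr measurable.
  by apply/seteqP; split=> x /=; rewrite in_itv/= andbT.
have m'F k : (m' (F k) <= (r k)%:E)%E.
  rewrite -(@lee_pmul2l _ (r k)%:E)// ?lte_fin//.
  apply: (@le_trans _ _ (\int[m']_x (h (f k) x)%:E)%E).
    have := @le_integral_comp_abse _ _ _ m' _ measurableT
      (fun x => (h (f k) x)%:E) (r k) id (@measurable_id _ _ _) (fun _ => id)
      (fun x y _ _ => id) (mh (f k)) (r0 k).
    rewrite setTI; congr (_ * m' _ <= _)%E.
      by apply/seteqP; split=> x /=; rewrite lee_fin ger0_norm.
    by apply: eq_integral => x _; rewrite gee0_abs// lee_fin.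
  by rewrite -EFinM -[leLHS]fineK ?h_fin// lee_fin ltW// uv.
have N0 : m' (lim_sup_set F) = 0%E.
  apply: lim_sup_set_cvg0 => //.
  apply: (@le_lt_trans _ _ (\sum_(k <oo) (2 / (2 ^ (k + 1))%:R : R)%:E)%E).
    apply: lee_nneseries => // k _; apply: (le_trans (m'F k)).
    rewrite lee_fin /r exprVn addn1 expnS natrM invfM mulrA divff// mul1r.
    by rewrite natrX.
  by have /cvg_lim -> // := @cvg_geometric_eseries_half R 2 0; rewrite ltry.
have mNF : measurable (lim_sup_set F).
  by apply: bigcapT_measurable => k; exact: bigcup_measurable.
have : \forall x \ae mu, ~ lim_sup_set F x.
  apply: (@ae_of_eprob _ _ _ _ m').
  by exists (lim_sup_set F); split=> // x /contrapT.
move=> Fx; rewrite /ae_cvg; near=> x.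
have xN : ~ lim_sup_set F x by near: x.
have [K KF] : exists K, forall j, (K <= j)%N -> ~ F j x.
  apply: contra_notP xN => /forallNP nK k _.
  by have /existsNP[j /not_implyP[kj /contrapT Fj]] := nK k; exists j.
have f0 : forall n, 0 <= f n x.
  by near: x; apply: ae_foralln => n; exact: pnorm_ge0.
have r_cvg : r n @[n --> \oo] --> (0 : R).
  by apply: cvg_expr; rewrite ger0_norm// invf_lt1// ltr1n.
apply: (squeeze_cvgr _ (cvg_cst 0) r_cvg); exists K => // n /= Kn.
rewrite f0/=; have /negP := KF n Kn; rewrite -ltNge /h (near (L00 mu) x)// subr0.
rewrite ger0_norm// gt_min => /orP[/ltW//|].
by rewrite ltNge /r exprn_ile1// invf_le1// ler1n.
Unshelve. all: by end_near. Qed.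

(** Dominated convergence: the truncated norms are at most 1 and [m'] is finite. *)
Lemma mdistL0_cvg V (u : nat -> V) v : ae_cvg u v ->
  mdistL0 (u n) v @[n --> \oo] --> (0 : R).
Proof.
move=> uv; have -> : (0 : R) = fine (\int[m']_x (cst 0%E : X -> \bar R) x)%E.
  by rewrite integral0.
apply: fine_cvg; rewrite fineK ?integral0//.
have [|||||_ _ +] := @dominated_convergence _ _ _ m' _ measurableT
   (fun k x => (h (pnorm (u k - v)) x)%:E) (cst 0%E) (cst 1%E).
- by move=> k; exact: mh.
- exact: measurable_cst.
- have : \forall x \ae mu, (h (pnorm (u k - v)) x)%:E @[k --> \oo] --> (0%E : \bar R).
    near=> x; apply: cvg_EFin; first exact: nearW.
    have u0 : `|pnorm (u k - v) x - (0 : L0 mu) x| @[k --> \oo] --> (0 : R).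
      rewrite (near (L00 mu) x)//; under eq_fun do rewrite subr0.
      by rewrite -(normr0 R); apply: cvg_norm; near: x; exact: uv.
    apply: (squeeze_cvgr _ (cvg_cst 0) u0); apply: nearW => k /=.
    by rewrite h_ge0/= ge_min lexx.
  by move=> /(ae_eprob m'); apply: filterS => x + _.
- apply/integrableP; split; first exact: measurable_cst.
  under eq_integral do rewrite abse1.
  by rewrite integral_cst// mul1e (le_lt_trans (eprob_le1 m'))// ltry.
- by apply: aeW => x k _ /=; rewrite lee_fin ger0_norm.
by rewrite integral0.
Unshelve. all: by end_near. Qed.

End L0_module.

Section isometric_graph.
Context {d : measure_display} {X : measurableType d} {R : realType}.
Context {mu : {measure set X -> \bar R}} {m' : equivProbability mu}.

(** Convergence almost everywhere, rather than in distance, lets the equality of pointwise norms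
    pass to the limit point by point; [ae_cvg_fast] links it to the distance. *)
Definition graph_closure (V W : normedL0ModType m') (G : V -> W -> Prop) v w :=
  exists t a, (forall n : nat, G (t n) (a n)) /\ ae_cvg t v /\ ae_cvg a w.

Lemma graph_closureC (V W : normedL0ModType m') (G : V -> W -> Prop) v w :
  graph_closure G v w <-> graph_closure (fun a b => G b a) w v.
Proof. by split=> -[t [a [Gta [tv aw]]]]; exists a, t. Qed.

(** Approximations [t n] of [v] are Cauchy, hence by isometry so are their partners [a n], and the
    completeness of [W] provides [w]. *)
Lemma graph_closure_total (V W : normedL0ModType m') (G : V -> W -> Prop) :
  (forall t a t' a', G t a -> G t' a' -> G (t - t') (a - a')) ->
  (forall t a, G t a -> pnorm t = pnorm a :> L0 mu) ->
  (forall v (e : R), 0 < e -> exists t a, G t a /\ mdistL0 t v < e) ->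
  forall v, exists w, graph_closure G v w.
Proof.
move=> GB GI Gd v; pose r n : R := 2^-1 ^+ n * 2^-1 ^+ n.
have r0 n : 0 < r n by rewrite mulr_gt0// exprn_gt0// invr_gt0.
have r_mono i j : (i <= j)%N -> r j <= r i.
  move=> ij; have h : (2^-1 : R) ^+ j <= 2^-1 ^+ i.
    by rewrite ler_wiXn2l ?invr_ge0// invf_le1// ler1n.
  by rewrite ler_pM ?exprn_ge0 ?invr_ge0.
have /choice[ta taP] n : exists ta : V * W, G ta.1 ta.2 /\ mdistL0 ta.1 v < r n.
  by have [t [a [Gta tv]]] := Gd v _ (r0 n); exists (t, a).
pose t n := (ta n).1; pose a n := (ta n).2.
have Gta n : G (t n) (a n) by have [] := taP n.
have tv n : mdistL0 (t n) v < r n by have [] := taP n.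
have r_cvg : r n @[n --> \oo] --> (0 : R).
  rewrite -(mulr0 0); apply: cvgM; apply: cvg_expr;
  by rewrite ger0_norm// invf_lt1// ltr1n.
have [w aw] : exists w, L0dist m' (pnorm (a n - w)) 0 @[n --> \oo] --> (0 : R).
  apply: L0_complete => e e0; have e20 : 0 < e / 2 by rewrite divr_gt0.
  move/cvgrPdist_lt : (r_cvg) => /(_ _ e20)[K _ rK]; exists K => i j Ki Kj.
  rewrite -(GI _ _ (GB _ _ _ _ (Gta i) (Gta j))) -/(mdistL0 _ _).
  rewrite (le_lt_trans (mdistL0_trans v _ _))// (splitr e) [X in _ + X]mdistL0C.
  have rKe k : (K <= k)%N -> r k < e / 2.
    by move=> /rK /=; rewrite sub0r normrN ger0_norm// ltW.
  by apply: ltrD; apply: lt_trans (tv _) _; exact: rKe.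
(* A subsequence along which [a] converges fast; [k <= n k] ensures that [t] keeps its own rate. *)
have /choice[n nP] k : exists n, (k <= n)%N /\ mdistL0 (a n) w < r k.
  move/cvgrPdist_lt : (aw) => /(_ _ (r0 k))[K _ aK].
  exists (maxn k K); split; first exact: leq_maxl.
  by have := aK _ (leq_maxr k K); rewrite /= sub0r normrN ger0_norm// L0dist_ge0.
exists w, (t \o n), (a \o n); split; first by move=> k; exact: Gta.
split; apply: ae_cvg_fast => k /=; have [kn akw] := nP k; last exact: akw.
by apply: lt_le_trans (tv _) _; exact: r_mono.
Qed.

Section properties.
Variables (V W : normedL0ModType m') (G : V -> W -> Prop).
Hypothesis GP : forall (f : L0 mu) t a t' a', G t a -> G t' a' ->
  G (f *: t + t') (f *: a + a').
Hypothesis GI : forall t a, G t a -> pnorm t = pnorm a :> L0 mu.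

Lemma ae_cvg_pnorm (U : normedL0ModType m') (u : nat -> U) z : ae_cvg u z ->
  \forall x \ae mu, pnorm (u n) x @[n --> \oo] --> pnorm z x.
Proof.
move=> uz; near=> x.
have uz0 : pnorm (u n - z) x @[n --> \oo] --> (0 : R) by near: x; exact: uz.
have uzd : forall n, `|pnorm (u n) x - pnorm z x| <= pnorm (u n - z) x.
  by near: x; apply: ae_foralln => n; exact: pnorm_dist.
apply/cvgrPdist_le => e e0; move/cvgrPdist_le : uz0 => /(_ _ e0).
apply: filterS => n; rewrite sub0r normrN distrC => /(le_trans _); apply.
exact: le_trans (uzd n) (ler_norm _).
Unshelve. all: by end_near. Qed.

Lemma ae_cvgP (U : normedL0ModType m') (f : L0 mu) (u u' : nat -> U) z z' :
  ae_cvg u z -> ae_cvg u' z' -> ae_cvg (fun n => f *: u n + u' n) (f *: z + z').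
Proof.
move=> uz uz'; rewrite /ae_cvg; near=> x.
have uz0 : pnorm (u n - z) x @[n --> \oo] --> (0 : R) by near: x; exact: uz.
have uz0' : pnorm (u' n - z') x @[n --> \oo] --> (0 : R) by near: x; exact: uz'.
have fuz : forall n, 0 <= pnorm (f *: u n + u' n - (f *: z + z')) x <=
    `|f x| * pnorm (u n - z) x + pnorm (u' n - z') x.
  near: x; apply: ae_foralln => n; near=> x; apply/andP; split.
    by near: x; exact: pnorm_ge0.
  rewrite opprD addrACA -scalerBr -(near (pnormZ f (u n - z)) x)//.
  by near: x; exact: ler_pnormD.
have fuz_cvg : `|f x| * pnorm (u n - z) x + pnorm (u' n - z') x @[n --> \oo] --> (0 : R).
  rewrite -(addr0 0) -(mulr0 `|f x|); apply: cvgD; last by rewrite mulr0.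
  exact: cvgMl_tmp.
by apply: (squeeze_cvgr _ (cvg_cst 0) fuz_cvg); exact: nearW.
Unshelve. all: by end_near. Qed.

Lemma graph_closure_pnorm v w : graph_closure G v w -> pnorm v = pnorm w :> L0 mu.
Proof.
move=> [t [a [Gta [tv aw]]]]; apply: L0P; near=> x.
have tv' : pnorm (t n) x @[n --> \oo] --> pnorm v x.
  by near: x; exact: ae_cvg_pnorm.
have aw' : pnorm (a n) x @[n --> \oo] --> pnorm w x.
  by near: x; exact: ae_cvg_pnorm.
suff tw : pnorm (t n) x @[n --> \oo] --> pnorm w x by exact: (cvg_unique _ tv' tw).
rewrite (_ : (fun n => _) = (fun n => pnorm (a n) x))//.
by apply/funext => n; rewrite (GI (Gta n)).
Unshelve. all: by end_near. Qed.

Lemma graph_closureP (f : L0 mu) v w v' w' :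
  graph_closure G v w -> graph_closure G v' w' ->
  graph_closure G (f *: v + v') (f *: w + w').
Proof.
move=> [t [a [Gta [tv aw]]]] [t' [a' [Gta' [tv' aw']]]].
exists (fun n => f *: t n + t' n), (fun n => f *: a n + a' n).
by split=> [n|]; [exact: GP|split; exact: ae_cvgP].
Qed.

(** The pair made of [0] and [w' - w] lies in the closure, whose pairs have equal pointwise
    norms. *)
Lemma graph_closure_fun v w w' :
  graph_closure G v w -> graph_closure G v w' -> w = w'.
Proof.
move=> vw vw'; have := graph_closureP (-1) vw vw'.
rewrite !scaleN1r addNr => /graph_closure_pnorm; rewrite pnorm0 => /esym.
by move=> /pnorm_eq0/eqP; rewrite addrC subr_eq0 => /eqP.
Qed.

End properties.

(** A relation rather than a map: an element may be a combination in several ways, and the isometry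
    alone shows that its image does not depend on the coefficients. The hypotheses are symmetric, so
    the inverse [psi] is obtained like [phi]. *)
Lemma isomorphic_dense_isometry (V W : normedL0ModType m') (G : V -> W -> Prop) :
  (forall (f : L0 mu) t a t' a', G t a -> G t' a' -> G (f *: t + t') (f *: a + a')) ->
  (forall t a, G t a -> pnorm t = pnorm a :> L0 mu) ->
  (forall v (e : R), 0 < e -> exists t a, G t a /\ mdistL0 t v < e) ->
  (forall w (e : R), 0 < e -> exists t a, G t a /\ mdistL0 a w < e) ->
  isomorphic V W.
Proof.
move=> GP GI GV GW.
have GB t a t' a' : G t a -> G t' a' -> G (t - t') (a - a').
  by move=> ta ta'; have := GP (-1) _ _ _ _ ta' ta; rewrite !scaleN1r ![- _ + _]addrC.
have /choice[phi phiP] := graph_closure_total GB GI GV.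
have /choice[psi psiP] : forall w, exists v, graph_closure G v w.
  move=> w; have [|||v vw] := @graph_closure_total W V (fun a t => G t a) _ _ _ w.
  - by move=> a t a' t'; exact: GB.
  - by move=> a t /GI.
  - by move=> {}w e /(GW w)[t [a ?]]; exists a, t.
  - by exists v; apply/graph_closureC.
have inj v v' w : graph_closure G v w -> graph_closure G v' w -> v = v'.
  move=> /graph_closureC vw /graph_closureC vw'.
  apply: graph_closure_fun vw vw' => [f a t a' t'|a t /GI//]; exact: GP.
have phi_linear : linear phi.
  move=> f u v; apply: graph_closure_fun (phiP _) _ => //.
  exact: graph_closureP.
pose phiL := GRing.isLinear.Build (L0 mu) V W *:%R _ phi_linear.
pose Phi : {linear V -> W} := HB.pack phi phiL.
exists Phi.
  exists psi => [v|w] /=; first exact: inj (psiP _) (phiP _).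
  exact: graph_closure_fun GP GI _ _ _ (phiP _) (psiP _).
by move=> v; apply/esym/(graph_closure_pnorm GI); exact: phiP.
Qed.

End isometric_graph.

(** * The bundle of the module *)

Definition lincomb (K : pzRingType) (V : lmodType K) (u : nat -> V) n (f : nat -> K) : V :=
  \sum_(i < n) f i *: u i.

Section lincomb.
Context {K : pzRingType}.

Lemma lincomb_widen (V : lmodType K) (u : nat -> V) n m (f : nat -> K) :
  (n <= m)%N -> lincomb u n f = lincomb u m (fun i => if (i < n)%N then f i else 0).
Proof.
move=> nm; rewrite /lincomb (big_ord_widen m (fun i => f i *: u i))//.
rewrite big_mkcond/=; apply: eq_bigr => i _.
by case: ifP; rewrite ?scale0r.
Qed.

(** [m] and [F] are chosen before the module. Pairs of combinations with equal coefficients in two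
    modules are therefore stable under linear combinations. *)
Lemma lincombP (c : K) n (f : nat -> K) n' (f' : nat -> K) :
  exists m F, forall (V : lmodType K) (u : nat -> V),
    c *: lincomb u n f + lincomb u n' f' = lincomb u m F.
Proof.
exists (maxn n n'), (fun i => c * (if (i < n)%N then f i else 0) +
  (if (i < n')%N then f' i else 0)) => V u.
rewrite (lincomb_widen _ _ (leq_maxl n n')) (lincomb_widen _ _ (leq_maxr n n')).
rewrite scaler_sumr -big_split/=; apply: eq_bigr => i _.
by rewrite scalerA -scalerDl.
Qed.

Lemma lincomb_single (V : lmodType K) (u : nat -> V) n (c : K) :
  c *: u n = lincomb u n.+1 (fun i => if i == n then c else 0).
Proof.
rewrite /lincomb big_ord_recr/= eqxx big1 ?add0r// => i _.
by rewrite ltn_eqF// scale0r.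
Qed.

End lincomb.

Section generators.
Context {d : measure_display} {X : measurableType d} {R : realType}.
Context {mu : {measure set X -> \bar R}} {m' : equivProbability mu}.

Definition L0cst (c : R) : L0 mu := L0class mu (cst c).

Lemma L0cstE c : \forall x \ae mu, L0cst c x = c.
Proof. exact: L0classE. Qed.

Lemma L0_ofP (f : X -> R) : measurable_fun setT f ->
  exists F : L0 mu, \forall x \ae mu, F x = f x.
Proof.
move=> mf; pose F : {mfun X >-> R} := mfun_Sub (mem_set mf).
by exists (L0class mu F); exact: L0classE.
Qed.

(** A generator [u n] is multiplied by [2^-n / (1 + |u n|)], which is invertible in [L0 mu] with
    inverse [k n], so that nothing is lost from the span. The term 1 keeps the quotient defined
    where [|u n|] vanishes. *)
Lemma countably_generatedP (M : normedL0ModType m') : countably_generated M ->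
  exists w : nat -> M, (forall n, \forall x \ae mu, pnorm (w n) x <= 2^-1 ^+ n) /\
    forall v (e : R), 0 < e -> exists n f, mdistL0 v (lincomb w n f) < e.
Proof.
move=> [C cC dC].
have [u Cu] : exists u : nat -> M, C `<=` range u.
  have [->|/set0P C0] := eqVneq C set0; first by exists (fun=> 0).
  have /pfcard_geP[C00|[u]] := cC; first by move: C0; rewrite C00 => -[].
  by exists u; rewrite (image_eq u).
have half0 n : 0 < 2^-1 ^+ n :> R by rewrite exprn_gt0// invr_gt0.
have /choice[g gE] n : exists g : L0 mu,
    \forall x \ae mu, g x = 2^-1 ^+ n * (1 + `|pnorm (u n) x|) `^ (-1).
  apply: L0_ofP; apply: measurable_funM => //.
  apply: (measurableT_comp (measurable_powR _)) => //.
  apply: measurable_funD => //; apply: measurableT_comp => //.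
have /choice[k kE] n : exists k : L0 mu,
    \forall x \ae mu, k x = (2^-1 ^+ n)^-1 * (1 + `|pnorm (u n) x|).
  apply: L0_ofP; apply: measurable_funM => //.
  apply: measurable_funD => //; apply: measurableT_comp => //.
have pos (r : R) : 0 < 1 + `|r| by rewrite ltr_pwDl.
pose w n := g n *: u n.
have uE n : u n = k n *: w n.
  rewrite scalerA [X in X *: _](_ : _ = 1) ?scale1r//; apply: L0P; near=> x.
  rewrite (near (L0M (k n) (g n)) x)// (near (L01 mu) x)//.
  rewrite (near (gE n) x)// (near (kE n) x)// powR_inv1 ?ltW//.
  by rewrite mulrACA mulVf ?gt_eqF// mul1r mulfV// gt_eqF.
exists w; split=> [n|v e /(dC v)[z Cz vz]].
  near=> x; rewrite (near (pnormZ (g n) (u n)) x)// (near (gE n) x)//.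
  rewrite powR_inv1 ?(ltW (pos _))// normrM normfV (gtr0_norm (pos _)) (gtr0_norm (half0 _)).
  rewrite -mulrA ler_piMr ?(ltW (half0 _))// mulrC ler_pdivrMr// mul1r.
  by rewrite (le_trans (ler_norm _))// lerDr.
pose S : set M := [set z | exists n f, z = lincomb w n f].
(* The span is the smallest submodule containing [C], so it lies in [S] once [S] is a submodule
   containing [C]. *)
have [|n [f zE]] := Cz S; last by exists n, f; rewrite -zE.
split=> [|_ /Cu[n _ <-]]; last first.
  by exists n.+1, (fun i => if i == n then k n else 0); rewrite uE lincomb_single.
split=> [|f _ _ [n [a ->]] [n' [a' ->]]].
  by exists 0%N, (fun=> 0); rewrite /lincomb big_ord0.
by have [m [F FE]] := lincombP f n a n' a'; exists m, F; rewrite FE.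
Unshelve. all: by end_near. Qed.

End generators.

Lemma ae_forall_countable (d : measure_display) (X : measurableType d) (R : realType)
    (mu : {measure set X -> \bar R}) (T : countType) (Q : T -> X -> Prop) :
  (forall t, \forall x \ae mu, Q t x) -> \forall x \ae mu, forall t, Q t x.
Proof.
move=> Qae; have : \forall x \ae mu, forall n, oapp (Q ^~ x) True (unpickle n).
  by apply: ae_foralln => n; case: (unpickle n) => [t|] /=; [exact: Qae|exact: aeW].
by apply: filterS => x Qx t; have := Qx (pickle t); rewrite pickleK.
Qed.

Section coordinates.
Context {d : measure_display} {X : measurableType d} {R : realType}.
Context {mu : {measure set X -> \bar R}} {m' : equivProbability mu}.

Lemma L0cst0 : L0cst 0 = 0 :> L0 mu.
Proof.
apply: L0P; near=> x.
by rewrite (near (L00 mu) x)// (near (L0cstE 0) x).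
Unshelve. all: by end_near. Qed.

Lemma L0cstD (a b : R) : L0cst (a + b) = L0cst a + L0cst b :> L0 mu.
Proof.
apply: L0P; near=> x; rewrite (near (L0D (L0cst a) (L0cst b)) x)//.
by rewrite (near (L0cstE (a + b)) x)// (near (L0cstE a) x)// (near (L0cstE b) x).
Unshelve. all: by end_near. Qed.

Lemma L0cstM (a b : R) : L0cst (a * b) = L0cst a * L0cst b :> L0 mu.
Proof.
apply: L0P; near=> x; rewrite (near (L0M (L0cst a) (L0cst b)) x)//.
by rewrite (near (L0cstE (a * b)) x)// (near (L0cstE a) x)// (near (L0cstE b) x).
Unshelve. all: by end_near. Qed.

Lemma pnorm_lincomb_le (V : normedL0ModType m') (u : nat -> V) n (f : nat -> L0 mu) :
  \forall x \ae mu, pnorm (lincomb u n f) x <= \sum_(i < n) `|f i x| * pnorm (u i) x.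
Proof.
elim: n => [|n ih].
  by rewrite /lincomb big_ord0 pnorm0; near=> x; rewrite (near (L00 mu) x)// big_ord0.
rewrite /lincomb big_ord_recr/= -/(lincomb u n f); near=> x.
rewrite big_ord_recr/= -(near (pnormZ (f n) (u n)) x)//.
have lx : pnorm (lincomb u n f) x <= \sum_(i < n) `|f i x| * pnorm (u i) x by near: x.
apply: le_trans (lerD lx (lexx _)).
by near: x; exact: ler_pnormD.
Unshelve. all: by end_near. Qed.

(** Rational constants as coefficients: for the generators [w], the pointwise norm of this element
    at [x] is the value of [p_x] at the rational polynomial [a]. *)
Definition ratcomb (V : lmodType (L0 mu)) (u : nat -> V) (a : {poly rat}) : V :=
  lincomb u (size a) (fun i => L0cst (ratr a`_i)).

Section ratcomb.
Context (V : lmodType (L0 mu)).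
Variable u : nat -> V.

Lemma ratcomb_widen m (a : {poly rat}) : (size a <= m)%N ->
  ratcomb u a = lincomb u m (fun i => L0cst (ratr a`_i)).
Proof.
move=> am; rewrite /ratcomb (lincomb_widen _ _ am); apply: eq_bigr => i _.
by case: ltnP => // /(nth_default 0) ->; rewrite rmorph0 L0cst0.
Qed.

Lemma ratcombD a b : ratcomb u (a + b) = ratcomb u a + ratcomb u b.
Proof.
pose m := maxn (size a) (size b).
rewrite (@ratcomb_widen m) ?size_polyD// (@ratcomb_widen m a) ?leq_maxl//.
rewrite (@ratcomb_widen m b) ?leq_maxr// /lincomb -big_split/=.
by apply: eq_bigr => i _; rewrite coefD rmorphD L0cstD scalerDl.
Qed.

Lemma ratcombZ c a : ratcomb u (c *: a) = L0cst (ratr c) *: ratcomb u a.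
Proof.
rewrite (@ratcomb_widen (size a)) ?size_scale_leq// scaler_sumr.
by apply: eq_bigr => i _; rewrite coefZ rmorphM L0cstM scalerA.
Qed.

End ratcomb.

Lemma polyQ_coef (a : {poly rat}) i : (polyQ R a)`_i = ratr a`_i.
Proof. by rewrite coef_map. Qed.

Lemma size_polyQ (a : {poly rat}) : (size (polyQ R a) <= size a)%N.
Proof. exact: size_poly. Qed.

(** An axiom of the pointwise norm holds outside a null set that depends on the elements involved;
    rational polynomials being countable, one null set [N] serves for all of them. *)
Lemma module_field (B : sepBanachType R) (M : normedL0ModType m') (w : nat -> M) :
  universal B -> (forall n, \forall x \ae mu, pnorm (w n) x <= 2^-1 ^+ n) ->
  exists J : X -> {linear {poly R} -> B},
    (forall v, measurable_fun setT ((fun x => J x v) : X -> borel B)) /\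
    (forall x v, `|J x v| <= l1norm v) /\
    \forall x \ae mu, forall a, `|J x (polyQ R a)| = pnorm (ratcomb w a) x.
Proof.
move=> uB w_le; pose P a := pnorm (ratcomb w a) : L0 mu.
have PD : \forall x \ae mu, forall ab : {poly rat} * {poly rat},
    P (ab.1 + ab.2) x <= P ab.1 x + P ab.2 x.
  by apply: ae_forall_countable => -[a b]; rewrite /P ratcombD; exact: ler_pnormD.
have PZ : \forall x \ae mu, forall ca : rat * {poly rat},
    P (ca.1 *: ca.2) x = `|ratr ca.1| * P ca.2 x.
  apply: ae_forall_countable => -[c a] /=; rewrite /P ratcombZ; near=> x.
  by rewrite (near (pnormZ (L0cst (ratr c)) (ratcomb w a)) x)// (near (L0cstE (ratr c)) x).
have P_le : \forall x \ae mu, forall a, P a x <= wnorm (polyQ R a).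
  apply: ae_forall_countable => a; near=> x.
  have : P a x <= \sum_(i < size a) `|L0cst (mu := mu) (ratr a`_i) x| * pnorm (w i) x.
    by near: x; exact: pnorm_lincomb_le.
  move=> /le_trans; apply.
  rewrite /wnorm (polysum_widen _ _ (size_polyQ a)) ?normr0//.
  apply: ler_sum => i _.
  have -> : L0cst (mu := mu) (ratr a`_i) x = ratr a`_i.
    by move: i; near: x; apply: ae_forall_countable => i; exact: L0cstE.
  rewrite polyQ_coef mulrC ler_wpM2r//.
  by move: i; near: x; apply: ae_forall_countable => i; exact: w_le.
have [N [mN N0 NP]] := filterI PD (filterI PZ P_le).
(* Outside the good set the seminorm, hence the fiber, is zero. *)
pose P' a x := \1_(~` N) x * P a x.
have P'0 a x : N x -> P' a x = 0.
  by move=> Nx; rewrite /P' indicE memNset ?mul0r//; exact.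
have P'1 a x : ~ N x -> P' a x = P a x.
  by move=> Nx; rewrite /P' indicE mem_set ?mul1r.
have good x : ~ N x -> (forall a b, P (a + b) x <= P a x + P b x) /\
    (forall c a, P (c *: a) x = `|ratr c| * P a x) /\
    forall a, P a x <= wnorm (polyQ R a).
  move=> xN; have [gD [gZ gl]] : [set x | (forall ab : {poly rat} * {poly rat},
      P (ab.1 + ab.2) x <= P ab.1 x + P ab.2 x)] x /\
      [set x | (forall ca : rat * {poly rat}, P (ca.1 *: ca.2) x = `|ratr ca.1| * P ca.2 x)] x
      /\ [set x | forall a, P a x <= wnorm (polyQ R a)] x.
    by apply: contra_notP xN => h; apply: NP.
  by split=> [a b|]; [exact: (gD (a, b))|split=> // c a; exact: (gZ (c, a))].
have [||||J [mJ [J1 JP]]] := @measurable_embedding _ X R P' B uB.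
- move=> a; apply: measurable_funM; last exact: measurable_L0.
  by apply: measurable_indic; exact: measurableC.
- move=> a b x; have [Nx|Nx] := pselect (N x); first by rewrite !P'0// addr0.
  by rewrite !P'1//; have [gD _] := good _ Nx.
- move=> c a x; have [Nx|Nx] := pselect (N x); first by rewrite !P'0// mulr0.
  by rewrite !P'1//; have [_ [gZ _]] := good _ Nx.
- move=> a x; have [Nx|Nx] := pselect (N x); last first.
    by rewrite !P'1//; have [_ [_ gl]] := good _ Nx.
  by rewrite P'0// polysum_ge0// invr_ge0.
exists J; split=> //; split=> //; exists N; split=> // x /= /existsNP[a Ja].
by apply: contra_notP Ja => Nx; rewrite JP P'1.
Unshelve. all: by end_near. Qed.

End coordinates.

Lemma closure_normP (R : realType) (V : normedModType R) (A : set V) (v : V) :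
  closure A v <-> forall e : R, 0 < e -> exists2 a, A a & `|v - a| < e.
Proof.
split=> [Av e e0|vA U /nbhs_ballP[e /= e0 eU]].
  have [a [Aa]] := Av _ (nbhsx_ballx v _ e0).
  by rewrite -ball_normE/=; exists a.
have [a Aa va] := vA _ e0; exists a; split=> //; apply: eU.
by rewrite -ball_normE.
Qed.

(** * The bundle of closed ranges and its coordinate sections *)

Section bundle_of_embedding.
Context {d : measure_display} {X : measurableType d} {R : realType}.
Context {B : sepBanachType R}.
Variable J : X -> {linear {poly R} -> B}.
Hypothesis mJ : forall v, measurable_fun setT ((fun x => J x v) : X -> borel B).
Hypothesis J1 : forall x v, `|J x v| <= l1norm v.

Definition closed_range (x : X) : Gr B.
Proof.
apply: (@ClosedSubspace R B (closure (range (J x)))).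
- exact: closed_closure.
- by apply: subset_closure; exists 0; rewrite ?linear0.
move=> a u v /closure_normP Eu /closure_normP Ev; apply/closure_normP => e e0.
have e20 : 0 < e / 2 by rewrite divr_gt0.
have a0 : 0 < `|a| + 1 by rewrite ltr_wpDl.
have [_ [p _ <-] up] := Eu _ (divr_gt0 e20 a0).
have [_ [q _ <-] vq] := Ev _ e20.
exists (J x (a *: p + q)); first by exists (a *: p + q).
rewrite linearP opprD addrACA -scalerBr (le_lt_trans (ler_normD _ _))//.
rewrite (splitr e) ler_ltD// normrZ.
move: up; rewrite ltr_pdivlMr// => /ltW; apply: le_trans.
by rewrite mulrC ler_wpM2l// lerDl.
Defined.

Lemma range_polyQ_dense x v (e : R) : 0 < e ->
  exists a, `|J x v - J x (polyQ R a)| < e.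
Proof.
move=> /(polyQ_approx v)[a va]; exists a.
by rewrite -linearB (le_lt_trans (J1 _ _)).
Qed.

(** An open set meets the closed range exactly when it contains the image of some rational
    polynomial, which leaves a countable union of measurable sets. *)
Lemma measurable_closed_range (U : set B) : open U ->
  measurable [set x | closed_range x `&` U !=set0].
Proof.
move=> oU; rewrite [X in measurable X](_ : _ =
    \bigcup_(a : {poly rat}) ((fun x => J x (polyQ R a)) @^-1` U)).
  apply: countable_bigcupT_measurable => [|a]; first exact: countableP.
  exact: borel_open.
apply/seteqP; split=> x /=; last first.
  move=> [a _ /= Ua]; exists (J x (polyQ R a)); split=> //.
  by apply: subset_closure; exists (polyQ R a).
move=> [u [Eu Uu]]; have [_ [[v _ <-] Uv]] := Eu _ (open_nbhs_nbhs (conj oU Uu)).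
have /nbhs_ballP[e /= e0 eU] : nbhs (J x v) U by exact: open_nbhs_nbhs.
have [a va] := range_polyQ_dense x v e0.
by exists a => //; apply: eU; rewrite -ball_normE.
Qed.

Definition range_bundle : bundle X B := Bundle measurable_closed_range.

Definition range_section (v : {poly R}) : section range_bundle.
Proof.
apply: (@Section _ _ _ _ range_bundle (fun x => J x v)); first exact: mJ.
by move=> x; apply: subset_closure; exists v.
Defined.

Context {mu : {measure set X -> \bar R}} (m' : equivProbability mu).
Local Notation E := range_bundle.
Local Notation GE := (Gamma mu E : normedL0ModType m').

Definition coord_section n : GE := secclass mu (range_section 'X^n).

Lemma lincomb_coordE n (f : nat -> L0 mu) : \forall x \ae mu,
  (lincomb coord_section n f : Gamma mu E) x = J x (\poly_(i < n) f i x).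
Proof.
elim: n => [|n ih].
  rewrite /lincomb big_ord0; near=> x.
  by rewrite (near (Gamma0 mu E) x)// poly_def big_ord0 linear0.
rewrite /lincomb big_ord_recr/= -/(lincomb coord_section n f); near=> x.
rewrite (near (GammaD (lincomb coord_section n f) (f n *: coord_section n)) x)//.
rewrite (near ih x)// (near (GammaZ (f n) (coord_section n)) x)//.
rewrite (near (secclassE mu (range_section 'X^n)) x)//=.
by rewrite -linearZ -linearD !poly_def big_ord_recr.
Unshelve. all: by end_near. Qed.

Lemma pnorm_GammaE (s : GE) : \forall x \ae mu, pnorm s x = `|(s : Gamma mu E) x|.
Proof. exact: Gamma_normE. Qed.

Lemma ratcomb_coordE (a : {poly rat}) : \forall x \ae mu,
  (ratcomb coord_section a : Gamma mu E) x = J x (polyQ R a).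
Proof.
have aE : \forall x \ae mu, forall i, L0cst (mu := mu) (ratr a`_i) x = ratr a`_i.
  by apply: ae_foralln => i; exact: L0cstE.
near=> x; rewrite (near (lincomb_coordE (size a) (fun i => L0cst (ratr a`_i))) x)//.
congr (J x _); apply/polyP => i; rewrite coef_poly polyQ_coef.
case: ltnP => [_|/(nth_default 0) ->]; last by rewrite rmorph0.
by move: i; near: x.
Unshelve. all: by end_near. Qed.

(* Both norms are Lipschitz in the coefficients, with the same constant at almost
   every [x] for all rational approximations of the coefficients at once. *)
Lemma pnorm_lincomb_coord (M : normedL0ModType m') (w : nat -> M) :
  (forall n, \forall x \ae mu, pnorm (w n) x <= 2^-1 ^+ n) ->
  (\forall x \ae mu, forall a, `|J x (polyQ R a)| = pnorm (ratcomb w a) x) ->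
  forall n (f : nat -> L0 mu),
    pnorm (lincomb coord_section n f) = pnorm (lincomb w n f) :> L0 mu.
Proof.
move=> w_le Jw n f; apply: L0P.
have wf : \forall x \ae mu, forall a : {poly rat},
    `|pnorm (lincomb w n f) x - pnorm (ratcomb w a) x| <=
    l1norm (\poly_(i < n) f i x - polyQ R a).
  apply: ae_forall_countable => a; pose m := maxn n (size a).
  pose g i : L0 mu := (if (i < n)%N then f i else 0) - L0cst (ratr a`_i).
  have fa : lincomb w n f - ratcomb w a = lincomb w m g.
    rewrite (lincomb_widen w f (leq_maxl n (size a))).
    rewrite (ratcomb_widen _ (leq_maxr n (size a))) -sumrB.
    by apply: eq_bigr => i _; rewrite scalerBl.
  have gE : \forall x \ae mu, forall i, g i x = (\poly_(i < n) f i x - polyQ R a)`_i.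
    apply: ae_foralln => i; near=> x; rewrite /g coefB coef_poly polyQ_coef.
    case: ifP => _; rewrite ?(near (L0D (f i) (- L0cst (ratr a`_i))) x)//.
      rewrite (near (L0N (L0cst (ratr a`_i))) x)//.
      by rewrite (near (L0cstE (ratr a`_i)) x).
    rewrite (near (L0D 0 (- L0cst (ratr a`_i))) x)//.
    rewrite (near (L0N (L0cst (ratr a`_i))) x)// (near (L00 mu) x)//.
    by rewrite (near (L0cstE (ratr a`_i)) x).
  near=> x; apply: (@le_trans _ _ (pnorm (lincomb w n f - ratcomb w a) x)).
    by near: x; exact: pnorm_dist.
  rewrite fa; apply: (@le_trans _ _ (\sum_(i < m) `|g i x| * pnorm (w i) x)).
    by near: x; exact: pnorm_lincomb_le.
  have gx : forall i, g i x = (\poly_(i < n) f i x - polyQ R a)`_i by near: x.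
  have wx : forall i, pnorm (w i) x <= 2^-1 ^+ i by near: x; exact: ae_foralln.
  rewrite /l1norm (@polysum_widen _ _ _ _ (normr0 R) m); last first.
    rewrite (leq_trans (size_polyD _ _))// size_polyN geq_max.
    by rewrite !(leq_trans (size_poly _ _)) ?leq_maxl ?leq_maxr.
  apply: ler_sum => i _; rewrite gx expr1n mul1r ler_piMr//.
  by apply: (le_trans (wx i)); rewrite exprn_ile1// invf_le1// ler1n.
near=> x; rewrite (near (pnorm_GammaE (lincomb coord_section n f)) x)//.
rewrite (near (lincomb_coordE n f) x)//.
have Jx : forall a, `|J x (polyQ R a)| = pnorm (ratcomb w a) x by near: x.
have wfx : forall a : {poly rat}, `|pnorm (lincomb w n f) x - pnorm (ratcomb w a) x| <=
    l1norm (\poly_(i < n) f i x - polyQ R a) by near: x.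
set F := \poly_(i < n) _ in wfx *.
apply/eqP; rewrite -subr_eq0 -normr_le0; apply/ler_addgt0Pr => e e0; rewrite add0r.
(* Both norms move by at most [e / 2] from [F] to a rational polynomial [a], where they coincide. *)
have [|a Fa] := @polyQ_approx _ F (e / 2); first by rewrite divr_gt0.
have := wfx a; rewrite -Jx.
have : `| `|J x F| - `|J x (polyQ R a)| | <= l1norm (F - polyQ R a).
  by rewrite (le_trans (ler_dist_dist _ _))// -linearB.
rewrite !ler_norml => /andP[? ?] /andP[? ?]; apply/andP; split; lra.
Unshelve. all: by end_near. Qed.

End bundle_of_embedding.

(** * Density of the combinations of coordinate sections *)

Section density.
Context {d : measure_display} {X : measurableType d} {R : realType}.
Context {B : sepBanachType R}.
Variable J : X -> {linear {poly R} -> B}.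
Hypothesis mJ : forall v, measurable_fun setT ((fun x => J x v) : X -> borel B).
Hypothesis J1 : forall x v, `|J x v| <= l1norm v.
Context {mu : {measure set X -> \bar R}} (m' : equivProbability mu).
Local Notation E := (range_bundle mJ J1).
Local Notation GE := (Gamma mu E : normedL0ModType m').

(** [c] is the indicator of the set where [a] is strictly closer to [s] than [t] is: the combination
    is [a] there and [t] elsewhere. Coefficients in [L0 mu] thus make the pointwise choice possible
    inside the module. *)
Lemma nearest_choice (s t a : GE) : exists c : L0 mu, \forall x \ae mu,
  `|(s : Gamma mu E) x - (c *: (a - t) + t : Gamma mu E) x| <=
    `|(s : Gamma mu E) x - (a : Gamma mu E) x| /\
  `|(s : Gamma mu E) x - (c *: (a - t) + t : Gamma mu E) x| <=
    `|(s : Gamma mu E) x - (t : Gamma mu E) x|.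
Proof.
pose A := [set x | (pnorm (s - a) : L0 mu) x < (pnorm (s - t) : L0 mu) x].
have mA : measurable A.
  have := @measurable_fun_ltr _ _ R setT _ _
    (@measurable_L0 _ _ _ mu (pnorm (s - a))) (@measurable_L0 _ _ _ mu (pnorm (s - t))).
  by move=> /(_ measurableT [set true] I); rewrite setTI.
have [c cA] : exists c : L0 mu, \forall x \ae mu, c x = \1_A x.
  by apply: L0_ofP; exact: measurable_indic.
exists c; near=> x.
have ux : (c *: (a - t) + t : Gamma mu E) x =
  \1_A x *: ((a : Gamma mu E) x - (t : Gamma mu E) x) + (t : Gamma mu E) x.
  rewrite (near (GammaD (c *: (a - t)) t) x)// (near (GammaZ c (a - t)) x)//.
  by rewrite (near (GammaB a t) x)// (near cA x).
have Ax : (x \in A) = (`|(s : Gamma mu E) x - (a : Gamma mu E) x| <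
    `|(s : Gamma mu E) x - (t : Gamma mu E) x|).
  apply/idP/idP; rewrite in_setE /A /=.
    rewrite (near (pnorm_GammaE (s - a)) x)// (near (pnorm_GammaE (s - t)) x)//.
    by rewrite (near (GammaB s a) x)// (near (GammaB s t) x).
  rewrite (near (pnorm_GammaE (s - a)) x)// (near (pnorm_GammaE (s - t)) x)//.
  by rewrite (near (GammaB s a) x)// (near (GammaB s t) x).
rewrite ux indicE Ax; case: ltP => h; rewrite ?scale1r ?scale0r ?subrK ?add0r//.
by split=> //; exact: ltW.
Unshelve. all: by end_near. Qed.

(** At almost every [x] the distance from [s x] to [t k x] decreases with [k] and ends up below the
    distance to each value of a rational combination. These values are dense in the fiber, so [t]
    converges to [s] almost everywhere, hence in distance. *)
Lemma lincomb_coord_dense (s : GE) (e : R) : 0 < e -> exists n f,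
  mdistL0 (lincomb (coord_section mJ J1 m') n f : GE) s < e.
Proof.
move=> e0; pose a k : GE := ratcomb (coord_section mJ J1 m') (odflt 0 (unpickle k)).
have /choice[c cP] (ta : GE * GE) := nearest_choice s ta.1 ta.2.
(* [t k x] is the element of [a 0 x, ..., a k.-1 x] (or 0) closest to [s x]. *)
pose t := fix t k : GE := if k is k'.+1 then
  c (t k', a k') *: (a k' - t k') + t k' else 0.
have tP k : exists n f, t k = lincomb (coord_section mJ J1 m') n f.
  elim: k => [|k [n [f tE]]].
    by exists 0%N, (fun=> 0); rewrite /lincomb big_ord0.
  pose q : {poly rat} := odflt 0 (unpickle k).
  have [m [g gE]] := lincombP (-1 : L0 mu) n f (size q) (fun i => L0cst (ratr q`_i)).
  have {gE} aE : a k - t k = lincomb (coord_section mJ J1 m') m g.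
    by rewrite -gE scaleN1r addrC tE.
  have [m2 [g2 g2E]] := lincombP (c (t k, a k)) m g n f.
  by exists m2, g2; rewrite /= -g2E aE -tE.
have ts : ae_cvg t s.
  have aJ : \forall x \ae mu, forall k,
      (a k : Gamma mu E) x = J x (polyQ R (odflt 0 (unpickle k))).
    by apply: ae_foralln => k; exact: ratcomb_coordE.
  have tc : \forall x \ae mu, forall k,
      `|(s : Gamma mu E) x - (t k.+1 : Gamma mu E) x| <=
        `|(s : Gamma mu E) x - (a k : Gamma mu E) x| /\
      `|(s : Gamma mu E) x - (t k.+1 : Gamma mu E) x| <=
        `|(s : Gamma mu E) x - (t k : Gamma mu E) x|.
    by apply: ae_foralln => k; exact: (cP (t k, a k)).
  have pt : \forall x \ae mu, forall k,
      (pnorm (t k - s) : L0 mu) x = `|(s : Gamma mu E) x - (t k : Gamma mu E) x|.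
    apply: ae_foralln => k; rewrite pnormBC; near=> x.
    rewrite (near (pnorm_GammaE (s - t k)) x)//.
    by rewrite (near (GammaB s (t k)) x).
  rewrite /ae_cvg; near=> x.
  have ptx : forall k,
      (pnorm (t k - s) : L0 mu) x = `|(s : Gamma mu E) x - (t k : Gamma mu E) x| by near: x.
  have aJx : forall k,
      (a k : Gamma mu E) x = J x (polyQ R (odflt 0 (unpickle k))) by near: x.
  have tcx : forall k,
      `|(s : Gamma mu E) x - (t k.+1 : Gamma mu E) x| <=
        `|(s : Gamma mu E) x - (a k : Gamma mu E) x| /\
      `|(s : Gamma mu E) x - (t k.+1 : Gamma mu E) x| <=
        `|(s : Gamma mu E) x - (t k : Gamma mu E) x| by near: x.
  apply/cvgrPdist_lt => r r0; have r20 : 0 < r / 2 by rewrite divr_gt0.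
  have /closure_normP/(_ _ r20)[_ [v _ <-] sv] := section_in (repr s) x.
  have [q vq] := range_polyQ_dense J1 x v r20.
  (* The candidate [a (pickle q)] is taken into account at the following index, and later choices
     only come closer to [s x]. *)
  exists (pickle q).+1 => // n /= qn; rewrite sub0r normrN ptx normr_id.
  have tn : `|(s : Gamma mu E) x - (t n : Gamma mu E) x| <=
      `|(s : Gamma mu E) x - (a (pickle q) : Gamma mu E) x|.
    elim: n qn => // n ih; rewrite ltnS leq_eqVlt => /predU1P[<-|qn].
      by have [] := tcx (pickle q).
    by apply: le_trans (ih qn); have [] := tcx n.
  apply: (le_lt_trans tn); rewrite aJx pickleK /= -(subrKA (J x v)).
  by rewrite (le_lt_trans (ler_normD _ _))// (splitr r) ltrD.
have /cvgrPdist_lt/(_ _ e0)[K _ /(_ K (leqnn K))] := mdistL0_cvg ts.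
rewrite /= sub0r normrN ger0_norm ?L0dist_ge0//.
by have [n [f ->]] := tP K; exists n, f.
Unshelve. all: by end_near. Qed.

End density.

Theorem theorem4p13 (d : measure_display) (X : measurableType d) (R : realType)
    (mu : {measure set X -> \bar R})
    (measurable_point : forall x : X, measurable [set x])
    (mu_complete : measure_is_complete mu)
    (mu_sigma_finite : sigma_finite [set: X] mu)
    (m' : equivProbability mu)
    (M : normedL0ModType m') (M_cg : countably_generated M)
    (B : sepBanachType R) (B_universal : universal B) :
  exists E : bundle X B, isomorphic (Gamma mu E : normedL0ModType m') M.
Proof.
have [w [w_le w_dense]] := countably_generatedP M_cg.
have [J [mJ [J1 Jw]]] := module_field B_universal w_le.
exists (range_bundle mJ J1); pose S := coord_section mJ J1 m'.
(* The coefficients [f] are common to both sides; they need not be determined by either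
   combination. *)
apply: (@isomorphic_dense_isometry _ _ _ _ _ _ _
  (fun t a => exists n f, t = lincomb S n f /\ a = lincomb w n f)).
- move=> f _ _ _ _ [n [g [-> ->]]] [n' [g' [-> ->]]].
  by have [m [h hE]] := lincombP f n g n' g'; exists m, h; rewrite !hE.
- by move=> _ _ [n [f [-> ->]]]; exact: pnorm_lincomb_coord.
- move=> s e /(lincomb_coord_dense s)[n [f fs]].
  by exists (lincomb S n f), (lincomb w n f); split=> //; exists n, f.
- move=> v e /(w_dense v)[n [f vf]]; rewrite mdistL0C in vf.
  by exists (lincomb S n f), (lincomb w n f); split=> //; exists n, f.
Qed.
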